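(* Let $\mathcal{S}$ be a submodule of $H^2(\mathbb{D}^n)$. Then $$(I_{\mathcal{S}}-R_{z_i}R_{z_i}^* )(I_{\mathcal{S}}-R_{z_j}R_{z_j}^* )=0\quad\text{for all distinct } i,j\in\{1,\ldots,n\}$$ if and only if $\mathcal{S}=\{0\}$.
   Context: Throughout $n\ge 2$. $H^2(\mathbb{D}^n)$ is the Hardy space of analytic functions $f$ on the unit polydisc $\mathbb{D}^n$ with $\|f\|=\sup_{0\le r<1}\big(\int_{\mathbb{T}^n}|f(r\boldsymbol z)|^2\,d\mu\big)^{1/2}<\infty$, where $\mu$ is normalized Lebesgue measure on $\mathbb{T}^n$; $M_{z_j}$ is multiplication by the coordinate function $z_j$. A submodule is a closed subspace $\mathcal{S}\subseteq H^2(\mathbb{D}^n)$ with $M_{z_j}\mathcal{S}\subseteq\mathcal{S}$ for all $j\in\{1,\ldots,n\}$; $I_{\mathcal{S}}$ is the identity on $\mathcal{S}$. $R_{z_j}:=M_{z_j}|_{\mathcal{S}}:\mathcal{S}\to\mathcal{S}$, with adjoint taken on $\mathcal{S}$. *)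

(* Defs.v *)
From HB Require Import structures.
From mathcomp Require Import all_boot all_order all_algebra.
From mathcomp Require Import all_classical all_reals all_analysis.
From mathcomp Require Export complex.

Set Implicit Arguments.
Unset Strict Implicit.
Unset Printing Implicit Defensive.

Import Order.TTheory GRing.Theory Num.Theory.
Import numFieldNormedType.Exports.

Local Open Scope classical_set_scope.
Local Open Scope ring_scope.
Local Open Scope complex_scope.

Notation normc := ComplexField.Normc.normc.

Section Polydisc.
Context {R : realType}.

Definition in_polydisc n (z : 'rV[R[i]]_n) : bool :=
  [forall j, normc (z ord0 j) < 1].

Definition polydisc n : Type := {z : 'rV[R[i]]_n | in_polydisc z}.

Definition monomial n (alpha : 'I_n -> nat) (z : 'rV[R[i]]_n) : R[i] :=
  \prod_(j < n) z ord0 j ^+ alpha j.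

(* The multi-indices of total degree k are enumerated as the functions
   'I_n -> {0, ..., k} whose values add up to k. *)
Definition homogeneous_part n (c : ('I_n -> nat) -> R[i]) (k : nat)
    (z : 'rV[R[i]]_n) : R[i] :=
  \sum_(alpha : {ffun 'I_n -> 'I_k.+1} | (\sum_j alpha j == k)%N)
    c (fun j => alpha j : nat) * monomial (fun j => alpha j : nat) z.

(* f is the sum, on the polydisc of polyradius rho centred at a, of a power
   series which converges absolutely at the polyradius rho; since the series
   is absolutely convergent, summing it by total degree is no restriction. *)
Definition analytic_at n (f : polydisc n -> R[i]) (a : polydisc n) : Prop :=
  exists (rho : R) (c : ('I_n -> nat) -> R[i]),
    [/\ 0 < rho,
        (\esum_(alpha in [set: 'I_n -> nat])
           (normc (c alpha) * rho ^+ (\sum_j alpha j)%N)%:E < +oo)%E &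
        forall w : polydisc n,
          (forall j, normc (val w ord0 j - val a ord0 j) < rho) ->
          (fun N => normc (\sum_(0 <= k < N)
                             homogeneous_part c k (val w - val a) - f w))
            @ \oo --> (0 : R)].

Definition analytic n (f : polydisc n -> R[i]) : Prop :=
  forall a, analytic_at f a.

End Polydisc.

Section Torus.
Context {R : realType}.
Let T : measurableType _ := measurableTypeR R.

Definition tcons n (x : T * n.-tuple T) : n.+1.-tuple T :=
  [the n.+1.-tuple T of x.1 :: x.2].

Lemma measurable_tcons n : measurable_fun [set: T * n.-tuple T] (@tcons n).
Proof. exact: measurable_cons. Qed.

HB.instance Definition _ n :=
  isMeasurableFun.Build _ _ _ _ (@tcons n) (@measurable_tcons n).

(* Lebesgue measure on [0, 1]^n. *)
Fixpoint unit_cube_prob n : probability (n.-tuple T) R :=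
  match n with
  | 0 => \d_ ([tuple] : 0.-tuple T)
  | m.+1 => distribution (uniform_prob (@ltr01 R) \x unit_cube_prob m)%E
              (@tcons m)
  end.

Definition expi (x : R) : R[i] := cos x +i* sin x.

(* The torus is parametrised by t |-> (exp (2 pi i t_j))_j, which carries
   unit_cube_prob to the normalised Lebesgue measure. *)
Definition torus_point n (r : R) (t : n.-tuple T) : 'rV[R[i]]_n :=
  \row_j (r%:C * expi (2 * pi * tnth t j)).

End Torus.

Section Hardy.
Context {R : realType}.
Local Notation C := R[i].

(* The value 0 outside of the polydisc is never used: hardy_norm only
   evaluates at points of modulus r < 1. *)
Definition extend0 n (f : polydisc n -> C) (z : 'rV[C]_n) : C :=
  oapp f 0 (insub z).

Definition circle_mean2 n (f : polydisc n -> C) (r : R) : \bar R :=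
  (\int[unit_cube_prob n]_t
     (normc (extend0 f (torus_point r t)) ^+ 2)%:E)%E.

Definition hardy_norm n (f : polydisc n -> C) : \bar R :=
  ereal_sup [set ((circle_mean2 f r) `^ 2^-1)%E | r in `[0, 1[].

Definition hardy n : set (polydisc n -> C) :=
  [set f | analytic f /\ (hardy_norm f < +oo)%E].

(* The inner product of H^2 (linear in f) is recovered from the norm by
   polarisation. *)
Definition hardy_inner n (f g : polydisc n -> C) : C :=
  4^-1 * \sum_(k < 4)
    'i ^+ k * ((fine (hardy_norm (f + 'i ^+ k *: g))) ^+ 2)%:C.

Definition Mz n (j : 'I_n) (f : polydisc n -> C) : polydisc n -> C :=
  fun w => val w ord0 j * f w.

Definition hardy_closed n (S : {pred (polydisc n -> C)}) : Prop :=
  forall f, hardy f ->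
    (forall e : R, 0 < e ->
       exists2 g, g \in S & (hardy_norm (f - g)%R < e%:E)%E) ->
    f \in S.

Record submodule n := Submodule {
  submodule_pred :> {pred (polydisc n -> C)};
  submodule_hardy : forall f, f \in submodule_pred -> hardy f;
  submodule_linear : submod_closed submodule_pred;
  submodule_closed : hardy_closed submodule_pred;
  submodule_Mz : forall j f, f \in submodule_pred -> Mz j f \in submodule_pred
}.

HB.instance Definition _ n (S : submodule n) :=
  GRing.isSubmodClosed.Build C (polydisc n -> C) (submodule_pred S)
    (submodule_linear S).

Record submodule_sort n (S : submodule n) := SubmoduleElt {
  submodule_val : polydisc n -> C;
  submodule_valP : submodule_val \in submodule_pred S
}.

HB.instance Definition _ n (S : submodule n) :=
  [isSub for @submodule_val n S].
HB.instance Definition _ n (S : submodule n) :=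
  [Choice of submodule_sort S by <:].
HB.instance Definition _ n (S : submodule n) :=
  [SubChoice_isSubLmodule of submodule_sort S by <:].

Definition Rz n (S : submodule n) (j : 'I_n) (f : submodule_sort S) :
    submodule_sort S :=
  SubmoduleElt (submodule_Mz j (submodule_valP f)).

(* The unique T' with <T f, g> = <f, T' g> on S, which exists for bounded
   linear T since S is a Hilbert space. *)
Definition adjoint n (S : submodule n)
    (T : submodule_sort S -> submodule_sort S) :
    submodule_sort S -> submodule_sort S :=
  fun g => xget 0 [set h | forall f : submodule_sort S,
    hardy_inner (val (T f)) (val g) = hardy_inner (val f) (val h)].

End Hardy.

Arguments Rz {R n} S j f.
Arguments polydisc R n : clear implicits.
Arguments submodule R n : clear implicits.

(* Main.v *)
Require Import Defs.
From mathcomp Require Import all_boot all_order all_algebra.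
From mathcomp Require Import all_classical all_reals all_analysis.
From mathcomp Require Import measurable_realfun.
From mathcomp Require Import ring lra.

(* Let P_j = I - R_j R_j^*.  Its values u are orthogonal to z_j S, and
   P_i P_j = 0 gives u = z_i g with g in S, where g is again orthogonal to z_j S;
   hence P_i g = P_i P_j g = 0 and the division by z_i can be repeated for ever.
   But u = z_i^k g_k with |g_k| = |u| bounds the mean of |u|^2 over the torus of
   radius r < 1 by r^(2k) |u|^2, so that u = 0.  Thus every f in S is z_j h with
   h in S, and the same bound gives f = 0.
   The norm is a supremum over r of circular means.  That it is a limit as r
   tends to 1, on which |z_j f| = |f| and the parallelogram law rest, is the
   monotonicity of these means; it follows variable by variable from the
   maximum principle for functions satisfying a sub-mean value inequality. *)

Set Implicit Arguments.
Unset Strict Implicit.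
Unset Printing Implicit Defensive.

Import Order.TTheory GRing.Theory Num.Theory.
Import numFieldNormedType.Exports.
Import ComplexField.Normc.

Local Open Scope classical_set_scope.
Local Open Scope ring_scope.
Local Open Scope complex_scope.

(** Analyticity is given by a separate power series around each point, so there is no global Taylor
    expansion at hand, and hence no Parseval formula for the norm. What is kept of the local series
    is that every one-variable slice is, near each point, a uniform limit of polynomials.
    Polynomials have an exact mean over roots of unity, and this yields the sub-mean inequality for
    |f|^2 in each variable. The inner product is defined by polarisation only, so even its
    additivity is a statement about norms. It is rewritten as an equality of two sums of squared
    norms and obtained by integrating a pointwise identity over one torus. A supremum does not
    commute with sums in general; monotonicity of the means is what lets one radius close to 1 serve
    all the terms at once. *)

Section Modulus.
Context {R : realType}.
Implicit Types (x y z : R[i]).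

Lemma normc_ge0 z : 0 <= normc z.
Proof. by case: z => a b; exact: sqrtr_ge0. Qed.

Lemma normc_sqr z : normc z ^+ 2 = complex.Re z ^+ 2 + complex.Im z ^+ 2.
Proof. by case: z => a b /=; rewrite sqr_sqrtr ?addr_ge0 ?sqr_ge0. Qed.

Lemma normcD x y : normc (x + y) <= normc x + normc y.
Proof. exact: le_normcD. Qed.

Lemma normc_opp z : normc (- z) = normc z.
Proof. exact: normcN. Qed.

Lemma normcBC x y : normc (x - y) = normc (y - x).
Proof. by rewrite -normc_opp opprB. Qed.

Lemma normc_sub_le x y : normc x <= normc y + normc (x - y).
Proof. by have := normcD y (x - y); rewrite addrC subrK. Qed.

Lemma normc_sub_trans z x y : normc (x - y) <= normc (x - z) + normc (z - y).
Proof. by have := normcD (x - z) (z - y); rewrite addrA subrK. Qed.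

Lemma normc_sum (I : Type) (r : seq I) (P : pred I) (F : I -> R[i]) :
  normc (\sum_(i <- r | P i) F i) <= \sum_(i <- r | P i) normc (F i).
Proof.
elim/big_rec2: _ => [|i y x _ le_xy]; first by rewrite normc0.
by apply: le_trans (normcD _ _) _; rewrite lerD2l.
Qed.

Lemma normc_prod (I : Type) (r : seq I) (P : pred I) (F : I -> R[i]) :
  normc (\prod_(i <- r | P i) F i) = \prod_(i <- r | P i) normc (F i).
Proof. exact: (big_morph _ (@normcM R) (normc1 R)). Qed.

Lemma normcX z n : normc (z ^+ n) = normc z ^+ n.
Proof. by elim: n => [|n IH]; rewrite ?expr0 ?normc1// !exprS normcM IH. Qed.

Lemma normcR (a : R) : normc a%:C = `|a|.
Proof. by rewrite /= expr0n addr0 sqrtr_sqr. Qed.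

Lemma normc_nat n : normc (n%:R : R[i]) = n%:R.
Proof. by rewrite -(rmorph_nat (real_complex R)) normcR ger0_norm. Qed.

Lemma normc_le_ReIm z : normc z <= `|complex.Re z| + `|complex.Im z|.
Proof.
rewrite -(@ler_pXn2r _ 2) ?nnegrE ?addr_ge0 ?normc_ge0//.
rewrite normc_sqr sqrrD !real_normK ?num_real//.
by rewrite lerD2r lerDl mulrn_wge0// mulr_ge0.
Qed.

Lemma normc_eq0 z : (normc z == 0) = (z == 0).
Proof. by apply/eqP/eqP => [/eq0_normc|->]; rewrite ?normc0. Qed.

Lemma normc_expi (t : R) : normc (expi t) = 1.
Proof. by rewrite /= cos2Dsin2 sqrtr1. Qed.

Lemma expiD (s t : R) : expi (s + t) = expi s * expi t.
Proof. by apply/eqP; rewrite eq_complex /= cosD sinD eqxx/= addrC. Qed.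

Lemma expi0 : expi 0 = 1 :> R[i].
Proof. by rewrite /expi cos0 sin0. Qed.

Lemma expiMn (t : R) n : expi (t *+ n) = expi t ^+ n.
Proof. by elim: n => [|n IH]; rewrite ?mulr0n ?expi0// mulrSr expiD IH exprSr. Qed.

Lemma expi_2pi : expi (2 * pi) = 1 :> R[i].
Proof. by rewrite /expi mulr_natl cos2pi sin2pi. Qed.

Lemma expi_eq1 (t : R) : 0 < t < 2 * pi -> expi t != 1.
Proof.
move=> /andP[t0 t2]; rewrite eq_complex /= negb_and; apply/orP; left.
have -> : t = (t / 2) *+ 2 by rewrite -mulr_natr divfK.
rewrite cos_mulr2n cos2sin2.
have : 0 < sin (t / 2) by apply: sin_gt0_pi; apply/andP; split; lra.
move=> /(exprn_gt0 2) s0; apply/eqP; lra.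
Qed.

Lemma expi_prim_root n : (0 < n)%N ->
  n.-primitive_root (expi (2 * pi / n%:R) : R[i]).
Proof.
move=> n0; apply/andP; split => //; apply/forallP => i.
have n0' : n%:R != 0 :> R by rewrite pnatr_eq0 -lt0n.
rewrite unity_rootE -expiMn; apply/eqP.
have [->|i_neq_n] := eqVneq i.+1 n.
  by rewrite -[_ *+ n]mulr_natr divfK // expi_2pi eqxx.
apply/negbTE/expi_eq1; rewrite -[_ *+ i.+1]mulr_natr.
have lt_in : (i.+1 < n)%N by rewrite ltn_neqAle i_neq_n /=.
have pi0 : 0 < 2 * pi :> R by rewrite mulr_gt0 ?pi_gt0.
rewrite !mulr_gt0 ?invr_gt0 ?ltr0n ?pi_gt0//= -mulrA gtr_pMr//.
by rewrite mulrC ltr_pdivrMr ?ltr0n// mul1r ltr_nat.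
Qed.

Lemma sum_expr_prim_root n (w : R[i]) k : n.-primitive_root w ->
  (0 < k < n)%N -> \sum_(l < n) (w ^+ k) ^+ l = 0.
Proof.
move=> w_prim /andP[k0 kn].
have wk1 : w ^+ k - 1 != 0.
  by rewrite subr_eq0 -(prim_order_dvd w_prim) gtnNdvd.
apply: (mulfI wk1); rewrite mulr0 -subrX1.
by rewrite -exprM mulnC exprM (prim_expr_order w_prim) expr1n subrr.
Qed.

(** Composing [p] with uX + b reduces the mean to sums of powers of [w]. Every exponent occurring is
    below [n], so all but the constant coefficient are killed by the geometric sum, and that
    coefficient is [p.[b]]. *)
Lemma horner_mean_prim_root n (w : R[i]) (p : {poly R[i]}) (b u : R[i]) :
  n.-primitive_root w -> (size p <= n)%N ->
  \sum_(l < n) p.[b + u * w ^+ l] = n%:R * p.[b].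
Proof.
move=> w_prim le_pn.
pose g := u *: 'X + b%:P; pose q := p \Po g.
have sq : (size q <= n)%N.
  have n0 := prim_order_gt0 w_prim.
  apply: (leq_trans (size_comp_poly_leq _ _)).
  have le2 : (size g <= 2)%N.
    apply: (leq_trans (size_polyD _ _)); rewrite geq_max.
    rewrite (leq_trans (size_scale_leq _ _)) ?size_polyX//.
    by rewrite (leq_trans (size_polyC_leq1 _)).
  case: (size p) le_pn => [|m] le_mn; first by rewrite mul0n.
  apply: leq_trans le_mn; rewrite ltnS -[leqRHS]muln1 leq_mul2l.
  by apply/orP; right; case: (size _) le2 => [|[|[|]]].
have q_eval l : p.[b + u * w ^+ l] = q.[w ^+ l].
  by rewrite horner_comp !hornerE addrC.
under eq_bigr do rewrite q_eval (horner_coef_wide _ sq).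
have -> : p.[b] = q`_0 by rewrite -horner_coef0 horner_comp !hornerE ?(mulr0, add0r).
rewrite exchange_big /=.
case: n w_prim le_pn sq => [/prim_order_gt0//|n] w_prim le_pn sq.
rewrite big_ord_recl /= [X in _ + X]big1 ?addr0 => [|i _].
  under eq_bigr do rewrite expr0 mulr1.
  by rewrite sumr_const card_ord mulr_natl.
have i_n : (0 < bump 0 i < n.+1)%N by exact: (ltn_ord (lift ord0 i)).
rewrite -mulr_sumr -[RHS](mulr0 q`_(bump 0 i)); congr (_ * _).
rewrite -[RHS](sum_expr_prim_root w_prim i_n).
by apply: eq_bigr => l _; rewrite -!exprM mulnC.
Qed.

End Modulus.

(** * The sub-mean value property and the maximum principle *)

Section Submean.
Context {R : realType}.
Implicit Types (z u w : R[i]) (eps rho : R).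

Definition root_mean (Phi : R[i] -> R) L z u : R :=
  (\sum_(l < L) Phi (z + u * expi (2 * pi / L%:R) ^+ l)) / L%:R.

(* Averaging over roots of unity instead of integrating over a circle makes
   the mean value property of polynomials exact and purely algebraic. *)
Definition submean_at (Phi : R[i] -> R) z := exists2 rho, 0 < rho &
  forall u, normc u < rho -> forall eps, 0 < eps ->
  exists L0 : nat, forall L, (L0 < L)%N -> Phi z <= root_mean Phi L z u + eps.

(** The only trace of analyticity that the sub-mean inequality uses. The radius comes before [eps],
    so one disc serves all precisions. *)
Definition poly_approx_at (phi : R[i] -> R[i]) z := exists2 rho, 0 < rho &
  forall eps, 0 < eps -> exists p : {poly R[i]},
  forall w, normc (w - z) < rho -> normc (phi w - p.[w]) <= eps.

Definition eps_continuous_at (Phi : R[i] -> R) z := forall eps, 0 < eps ->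
  exists2 delta, 0 < delta &
  forall w, normc (w - z) < delta -> `|Phi w - Phi z| < eps.

(** The Cauchy-Schwarz inequality against the constant 1, read off from the non-negativity of the
    variance. *)
Lemma sqr_sum_le L (a : 'I_L -> R) :
  (\sum_l a l) ^+ 2 <= L%:R * \sum_l a l ^+ 2.
Proof.
case: L a => [|L] a; first by rewrite !big_ord0 expr0n mul0r.
set s := \sum_l a l; pose m := s / L.+1%:R.
have L0 : L.+1%:R != 0 :> R by rewrite pnatr_eq0.
have sE : s = L.+1%:R * m by rewrite mulrC divfK.
have : 0 <= \sum_l (a l - m) ^+ 2 by apply: sumr_ge0 => l _; exact: sqr_ge0.
have -> : \sum_l (a l - m) ^+ 2 = \sum_l a l ^+ 2 - 2 * m * s + L.+1%:R * m ^+ 2.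
  rewrite /s mulr_sumr -sumrB.
  have -> : L.+1%:R * m ^+ 2 = \sum_(l < L.+1) m ^+ 2.
    by rewrite sumr_const card_ord mulr_natl.
  by rewrite -big_split; apply: eq_bigr => l _ /=; ring.
rewrite -(pmulr_rge0 _ (ltr0Sn R L)) -[_ <= L.+1%:R * _]subr_ge0.
by rewrite sE; lra.
Qed.

Lemma normc_expi_root L l : normc (expi (2 * pi / L%:R : R) ^+ l) = 1.
Proof. by rewrite normcX normc_expi expr1n. Qed.

(** Replacing [phi] by a polynomial costs [delta] at the centre and [delta] on the circle, so that
    |phi(z)| is at most the mean of |phi| plus 2 [delta]; Cauchy-Schwarz then passes to the
    squares. *)
Lemma submean_at_sqr (phi : R[i] -> R[i]) z :
  poly_approx_at phi z -> submean_at (fun w => normc (phi w) ^+ 2) z.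
Proof.
move=> [rho rho0 approx]; exists rho => // u u_rho eps eps0.
pose a := normc (phi z).
have a0 : 0 <= a := normc_ge0 _.
(* Squaring a - 2 [delta] loses at most 4 [delta] a, which this choice keeps below [eps]; the + 1
   covers a = 0. *)
pose delta := eps / (4 * (a + 1)).
have delta0 : 0 < delta by rewrite divr_gt0// mulr_gt0// ltr_wpDl.
have [p papprox] := approx _ delta0.
exists (size p) => L pL.
have L0 : (0 < L)%N by exact: leq_trans pL.
have LR : 0 < L%:R :> R by rewrite ltr0n.
pose w : R[i] := expi (2 * pi / L%:R).
pose x l := z + u * w ^+ l.
have approx_x l : normc (phi (x l) - p.[x l]) <= delta.
  by apply: papprox; rewrite /x addrC addKr normcM normc_expi_root mulr1.
have approx_z : normc (phi z - p.[z]) <= delta.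
  by apply: papprox; rewrite subrr normc0.
have mean_p := horner_mean_prim_root z u (expi_prim_root L0) (ltnW pL).
pose A := (\sum_(l < L) normc (phi (x l))) / L%:R.
have aA : a - 2 * delta <= A.
  have : L%:R * a <= \sum_(l < L) normc (phi (x l)) + L%:R * (2 * delta).
    rewrite -[in leLHS]normc_nat -normcM.
    have -> : L%:R * phi z = \sum_(l < L) phi (x l)
        + \sum_(l < L) (p.[x l] - phi (x l)) + L%:R * (phi z - p.[z]).
      by rewrite sumrB mean_p; ring.
    apply: le_trans (normcD _ _) _; 
    have -> : L%:R * (2 * delta) = L%:R * delta + L%:R * delta by ring.
    rewrite addrA.
    rewrite lerD ?normcM ?normc_nat ?ler_wpM2l//.
    apply: le_trans (normcD _ _) _; rewrite lerD ?normc_sum//.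
    apply: le_trans (normc_sum _ _ _) _.
    have -> : L%:R * delta = \sum_(l < L) delta.
      by rewrite sumr_const card_ord mulr_natl.
    by apply: ler_sum => l _; rewrite normcBC.
  by rewrite /A ler_pdivlMr// => h; lra.
have A2 : A ^+ 2 <= root_mean (fun w => normc (phi w) ^+ 2) L z u.
  rewrite /A expr_div_n /root_mean ler_pdivrMr ?exprn_gt0//.
  rewrite [L%:R ^+ 2]expr2 mulrA divfK ?gt_eqF// [leRHS]mulrC.
  exact: (sqr_sum_le (fun l => normc (phi (x l)))).
have A0 : 0 <= A by rewrite divr_ge0// sumr_ge0// => l _; exact: normc_ge0.
suff : a ^+ 2 <= A ^+ 2 + eps by rewrite -/a; lra.
have da : 4 * delta * a <= eps.
  have : delta * (4 * (a + 1)) = eps by rewrite divfK// mulf_neq0// gt_eqF// ltr_wpDl.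
  by nra.
(* Squaring needs a - 2 [delta] to be non-negative; otherwise a^2 is itself below [eps]. *)
have [le_a|lt_a] := leP (2 * delta) a; last by nra.
have : (a - 2 * delta) ^+ 2 <= A ^+ 2 by rewrite ler_pXn2r// nnegrE; lra.
by nra.
Qed.

Lemma submean_atD Phi Psi z : submean_at Phi z -> submean_at Psi z ->
  submean_at (Phi \+ Psi) z.
Proof.
move=> [r1 r10 h1] [r2 r20 h2]; exists (Num.min r1 r2).
  by rewrite lt_min r10.
move=> u; rewrite lt_min => /andP[u1 u2] eps eps0.
have e2 : 0 < eps / 2 by rewrite divr_gt0.
have [L1 hL1] := h1 _ u1 _ e2; have [L2 hL2] := h2 _ u2 _ e2.
exists (maxn L1 L2) => L; rewrite gtn_max => /andP[l1 l2].
rewrite /root_mean /= big_split mulrDl /=.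
by have := hL1 _ l1; have := hL2 _ l2; rewrite /root_mean; lra.
Qed.

Lemma submean_at_sum (K : nat) (Phi : nat -> R[i] -> R) z :
  (forall k, (k < K)%N -> submean_at (Phi k) z) ->
  submean_at (fun w => \sum_(k < K) Phi k w) z.
Proof.
elim: K => [|K IH] h.
  exists 1 => // u _ eps eps0; exists 0%N => L _.
  by rewrite /root_mean big_ord0 big1 ?mul0r ?add0r 1?ltW// => l _; rewrite big_ord0.
have -> : (fun w => \sum_(k < K.+1) Phi k w)
    = (fun w => \sum_(k < K) Phi k w) \+ Phi K.
  by apply/funext => w; rewrite big_ord_recr.
by apply: submean_atD; [apply: IH => k kK; apply: h; exact: ltnW | exact: h].
Qed.

Lemma submean_at_rot Phi z c : normc c = 1 -> submean_at Phi (z * c) ->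
  submean_at (fun w => Phi (w * c)) z.
Proof.
move=> c1 [rho rho0 h]; exists rho => // u u_rho eps eps0.
have [|L0 hL0] := h (u * c) _ _ eps0; first by rewrite normcM c1 mulr1.
exists L0 => L /hL0 h'; apply: le_trans h' _.
rewrite lerD2r /root_mean ler_wpM2r ?invr_ge0 ?ler0n//.
by apply: ler_sum => l _; rewrite
  (_ : (z + _) * c = z * c + u * c * expi (2 * pi / L%:R) ^+ l)//; ring.
Qed.

Lemma eps_continuous_at_sum (K : nat) (Phi : nat -> R[i] -> R) z :
  (forall k, (k < K)%N -> eps_continuous_at (Phi k) z) ->
  eps_continuous_at (fun w => \sum_(k < K) Phi k w) z.
Proof.
elim: K => [|K IH] h eps eps0.
  by exists 1 => // w _; rewrite !big_ord0 subrr normr0.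
have e2 : 0 < eps / 2 by rewrite divr_gt0.
have [|d1 d10 h1] := IH _ _ e2; first by move=> k kK; apply: h; exact: ltnW.
have [d2 d20 h2] := h _ (ltnSn K) _ e2.
exists (Num.min d1 d2) => [|w]; first by rewrite lt_min d10.
rewrite lt_min => /andP[/h1 w1 /h2 w2]; rewrite !big_ord_recr /= opprD addrACA.
by apply: le_lt_trans (ler_normD _ _) _; rewrite [ltRHS]splitr ltrD.
Qed.

Lemma eps_continuous_at_rot Phi z c : normc c = 1 ->
  eps_continuous_at Phi (z * c) -> eps_continuous_at (fun w => Phi (w * c)) z.
Proof.
move=> c1 h eps /h[d d0 hd]; exists d => // w wz; apply: hd.
by rewrite -mulrBl normcM c1 mulr1.
Qed.

(** The angle is taken in a compact interval, so that a disc is the image of a rectangle on which a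
    continuous function attains its maximum. *)
Lemma polar_form z :
  exists2 t : R, -1 <= t <= 1 & z = (normc z)%:C * expi (2 * pi * t).
Proof.
have pi0 : 0 < 2 * pi :> R by rewrite mulr_gt0// pi_gt0.
suff [t t_pi zt] : exists2 t, `|t| <= pi & z = (normc z)%:C * expi t.
  exists (t / (2 * pi)); last by rewrite [2 * pi * _]mulrC divfK// gt_eqF.
  rewrite -ler_norml normrM normfV (gtr0_norm pi0) ler_pdivrMr// mul1r.
  by apply: (le_trans t_pi); rewrite ler_peMl ?pi_ge0// ler1n.
have [->|z0] := eqVneq z 0.
  by exists 0; rewrite ?normr0 ?pi_ge0// normc0 mul0r.
have nz0 : normc z != 0 by rewrite normc_eq0.
case: z z0 nz0 => a b _; set r := normc _ => r0.
have r2 : r ^+ 2 = a ^+ 2 + b ^+ 2 by rewrite normc_sqr.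
have ab1 : (a / r) ^+ 2 + (b / r) ^+ 2 = 1.
  by rewrite !expr_div_n -mulrDl -r2 divff// expf_neq0.
have a1 : -1 <= a / r <= 1.
  rewrite -ler_norml -(@ler_pXn2r _ 2) ?nnegrE// real_normK ?num_real//.
  by rewrite expr1n -ab1 lerDl sqr_ge0.
have sE : sin (acos (a / r)) = `|b / r|.
  by rewrite sin_acos// -ab1 addrC addKr sqrtr_sqr.
have cE : cos (acos (a / r)) = a / r by rewrite acosK// in_itv.
have acos_pi : `|acos (a / r)| <= pi by rewrite ger0_norm ?acos_lepi ?acos_ge0.
have [b0|b0] := leP 0 (b / r).
  exists (acos (a / r)) => //; apply/eqP; rewrite eq_complex /= sE cE ger0_norm//.
  by rewrite !mul0r subr0 addr0 ![r * _]mulrC !divfK// !eqxx.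
exists (- acos (a / r)); rewrite ?normrN//; apply/eqP.
rewrite eq_complex /= sinN cosN sE cE ltr0_norm// opprK.
by rewrite !mul0r subr0 addr0 ![r * _]mulrC !divfK// !eqxx.
Qed.

End Submean.

Section MaximumPrinciple.
Context {R : realType}.
Implicit Types (z u w : R[i]) (eps s : R).

Lemma normc_sqr_continuous (a : R[i]) eps : 0 < eps ->
  exists2 delta, 0 < delta &
  forall b, normc (b - a) < delta -> `|normc b ^+ 2 - normc a ^+ 2| < eps.
Proof.
move=> eps0; pose m := 2 * normc a + 1.
have na0 : 0 <= normc a := normc_ge0 _.
have m0 : 0 < m by rewrite /m; lra.
exists (Num.min 1 (eps / m)) => [|b]; first by rewrite lt_min ltr01 divr_gt0.
rewrite lt_min ltr_pdivlMr// => /andP[ba1 bam].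
have h1 := normc_sub_le b a; have h2 := normc_sub_le a b.
rewrite normcBC in h2.
rewrite subr_sqr normrM; set d := normc (b - a) in ba1 bam h1 h2.
have le_d : `|normc b - normc a| <= d by rewrite ler_norml; apply/andP; split; lra.
have le_m : `|normc b + normc a| <= m.
  by rewrite ger0_norm ?addr_ge0 ?normc_ge0// /m; lra.
by apply: le_lt_trans bam; rewrite ler_pM.
Qed.

Lemma ReD z w : complex.Re (z + w) = complex.Re z + complex.Re w.
Proof. by case: z w => [? ?] []. Qed.

Lemma ImD z w : complex.Im (z + w) = complex.Im z + complex.Im w.
Proof. by case: z w => [? ?] []. Qed.

Lemma Re_sum I (r : seq I) (F : I -> R[i]) :
  complex.Re (\sum_(i <- r) F i) = \sum_(i <- r) complex.Re (F i).
Proof. exact: (big_morph _ ReD). Qed.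

Lemma Im_sum I (r : seq I) (F : I -> R[i]) :
  complex.Im (\sum_(i <- r) F i) = \sum_(i <- r) complex.Im (F i).
Proof. exact: (big_morph _ ImD). Qed.

(** The cross terms cancel because the roots of unity sum to 0. The surplus |u|^2 over the value at
    the centre makes |w|^2 a strict perturbation for the maximum principle. *)
Lemma root_mean_normc_sqr L z u : (1 < L)%N ->
  root_mean (fun w => normc w ^+ 2) L z u = normc z ^+ 2 + normc u ^+ 2.
Proof.
move=> L1; have L0 : (0 < L)%N := ltnW L1.
have LR : L%:R != 0 :> R by rewrite pnatr_eq0 -lt0n.
rewrite /root_mean; apply: (mulIf LR); rewrite divfK//.
set b := fun l : nat => u * expi (2 * pi / L%:R) ^+ l.
have b2 l : normc (b l) ^+ 2 = normc u ^+ 2.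
  by rewrite normcM normc_expi_root mulr1.
have b_sum : \sum_(l < L) b l = 0.
  have := sum_expr_prim_root (expi_prim_root (R := R) L0) (k := 1%N) L1.
  by rewrite expr1 -mulr_sumr => ->; rewrite mulr0.
rewrite (eq_bigr (fun l : 'I_L => normc z ^+ 2 + normc u ^+ 2 +
  2 * complex.Re z * complex.Re (b l) + 2 * complex.Im z * complex.Im (b l))).
  rewrite !big_split /= -!mulr_sumr -Re_sum -Im_sum b_sum /= !mulr0 !addr0.
  have sumc (c : R) : \sum_(l < L) c = c * L%:R.
    by rewrite sumr_const card_ord mulr_natr.
  by rewrite !sumc mulrDl !mulrA.
by move=> l _; rewrite -(b2 l) -/(b l) !normc_sqr ReD ImD; ring.
Qed.

Lemma continuous_polar (G : R[i] -> R) (p : R * R) :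
  eps_continuous_at G (p.1%:C * expi (2 * pi * p.2)) ->
  {for p, continuous (fun q : R * R => G (q.1%:C * expi (2 * pi * q.2)))}.
Proof.
move=> cG; apply/cvgrPdist_lt => eps eps0.
have [delta delta0 hG] := cG _ eps0.
have d2 : 0 < delta / 2 by rewrite divr_gt0.
have ccos : (fun q : R * R => q.1 * cos (2 * pi * q.2)) @ p --> p.1 * cos (2 * pi * p.2).
  apply: cvgM; first exact: cvg_fst.
  apply: continuous_cvg; first exact: continuous_cos.
  by apply: cvgM; [exact: cvg_cst | exact: cvg_snd].
have csin : (fun q : R * R => q.1 * sin (2 * pi * q.2)) @ p --> p.1 * sin (2 * pi * p.2).
  apply: cvgM; first exact: cvg_fst.
  apply: continuous_cvg; first exact: continuous_sin.
  by apply: cvgM; [exact: cvg_cst | exact: cvg_snd].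
near=> q; rewrite distrC; apply: hG.
apply: le_lt_trans (normc_le_ReIm _) _.
rewrite /= !mul0r !subr0 !addr0 [ltRHS]splitr ltrD//; rewrite distrC.
- by near: q; move/cvgrPdist_lt : ccos; exact.
- by near: q; move/cvgrPdist_lt : csin; exact.
Unshelve. all: by end_near. Qed.

(** A sub-mean function may have interior maxima, so a small multiple of |w|^2 is added. The sum [G]
    attains its maximum over the closed disc, and an interior maximum would contradict the strict
    gain on a small circle around it. *)
Lemma max_principle (Phi : R[i] -> R) s eps z : 0 < eps -> normc z <= s ->
  (forall w, normc w <= s -> submean_at Phi w /\ eps_continuous_at Phi w) ->
  exists t : R, Phi z <= Phi (s%:C * expi (2 * pi * t)) + eps.
Proof.
move=> eps0 zs hPhi; have s0 : 0 <= s := le_trans (normc_ge0 _) zs.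
(* The perturbation is at most e s^2 on the disc, hence below [eps]; the + 1 covers s = 0. *)
pose e := eps / (s ^+ 2 + 1).
have s20 : 0 < s ^+ 2 + 1 by rewrite ltr_wpDl ?sqr_ge0.
have e0 : 0 < e by rewrite divr_gt0.
pose G w := Phi w + e * normc w ^+ 2.
have cG w : normc w <= s -> eps_continuous_at G w.
  move=> /hPhi[_ cPhi] d d0; have d2 : 0 < d / 2 by rewrite divr_gt0.
  have [d1 d10 h1] := cPhi _ d2.
  have de : 0 < d / 2 / e by rewrite divr_gt0.
  have [d3 d30 h3] := normc_sqr_continuous w de.
  exists (Num.min d1 d3) => [|v]; first by rewrite lt_min d10.
  rewrite lt_min => /andP[/h1 v1 /h3]; rewrite ltr_pdivlMr// => v3.
  rewrite /G opprD addrACA -mulrBr; apply: le_lt_trans (ler_normD _ _) _.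
  by rewrite [ltRHS]splitr ltrD// normrM gtr0_norm// mulrC.
pose A := `[0, s]%classic `*` `[-1, 1]%classic : set (R * R).
have cA : compact A by apply: compact_setX; exact: segment_compact.
have A0 : A !=set0 by exists (0, 0); split; rewrite /= in_itv/= ?lexx//; lra.
pose pol (q : R * R) := q.1%:C * expi (2 * pi * q.2).
have pol_norm (q : R * R) : 0 <= q.1 -> normc (pol q) = q.1.
  by move=> q0; rewrite normcM normc_expi normcR mulr1 ger0_norm.
have [|q1] := @compact_EVT_max _ _ (G \o pol) A A0 cA.
  apply: continuous_in_subspaceT => p; rewrite inE => -[/= ].
  rewrite !in_itv /= => /andP[p0 ps] _.
  by apply: continuous_polar; apply: cG; rewrite pol_norm.
rewrite inE => -[]; rewrite /= !in_itv /= => /andP[r0 rs] _ qmax.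
have Gmax w : normc w <= s -> G w <= G (pol q1).
  move=> ws; have [t t1 ->] := polar_form w.
  by apply: (qmax (normc w, t)); rewrite inE; split; rewrite /= in_itv /= ?normc_ge0.
have esE : e * (s ^+ 2 + 1) = eps by rewrite divfK// gt_eqF.
have Gz : Phi z <= G (pol q1).
  apply: le_trans (Gmax _ zs); rewrite /G lerDl.
  by rewrite mulr_ge0// ?sqr_ge0// ltW.
have [eq_rs|lt_rs] := eqVneq q1.1 s.
  exists q1.2; apply: (le_trans Gz); rewrite /G pol_norm// /pol eq_rs lerD2l.
  by rewrite -esE ler_pM2l// lerDl.
have {}lt_rs : q1.1 < s by rewrite lt_neqAle lt_rs.
have [[rho rho0 hsub] _] := hPhi (pol q1) ltac:(by rewrite pol_norm).
(* The circle of radius [v] around the maximum point lies in the disc of radius [s] and within reach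
   of the sub-mean inequality. Half of the gain e v^2 is then spent as its tolerance. *)
pose v := Num.min (rho / 2) (s - q1.1).
have v0 : 0 < v by rewrite lt_min divr_gt0//= subr_gt0.
have nv : normc v%:C = v by rewrite normcR gtr0_norm.
have [||L0 hL0] := hsub v%:C _ (e * v ^+ 2 / 2) _.
- by rewrite nv gt_min; apply/orP; left; lra.
- by rewrite divr_gt0// mulr_gt0// exprn_gt0.
have {hL0} := hL0 (maxn L0 1).+1 (leq_maxl _ _).
set L := (maxn L0 1).+1 => subL.
have L1 : (1 < L)%N by rewrite ltnS leq_maxr.
have LR : 0 < L%:R :> R by rewrite ltr0n.
have : root_mean G L (pol q1) v%:C <= G (pol q1).
  rewrite /root_mean ler_pdivrMr// mulr_natr.
  have -> : G (pol q1) *+ L = \sum_(l < L) G (pol q1) by rewrite sumr_const card_ord.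
  apply: ler_sum => l _; apply: Gmax; apply: le_trans (normcD _ _) _.
  rewrite (normcM v%:C) normc_expi_root mulr1 nv pol_norm//.
  by rewrite -lerBrDl ge_min lexx orbT.
have -> : root_mean G L (pol q1) v%:C = root_mean Phi L (pol q1) v%:C
    + e * root_mean (fun w => normc w ^+ 2) L (pol q1) v%:C.
  by rewrite /root_mean big_split mulrDl -mulr_sumr mulrA.
rewrite root_mean_normc_sqr// nv /G.
have : 0 < e * v ^+ 2 by rewrite mulr_gt0// exprn_gt0.
by move: subL; lra.
Qed.

End MaximumPrinciple.

(** * Means over circles *)

Section RiemannSums.
Context {R : realType}.
Implicit Types (g : R -> R) (eps : R).

Lemma integral_unif_split g K : (0 < K)%N -> continuous g -> (forall x, 0 <= g x) ->
  (\int[uniform_prob (@ltr01 R)]_x (g x)%:E =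
   \sum_(k < K) \int[lebesgue_measure]_(x in
     `[(k%:R / K%:R)%R, (k.+1%:R / K%:R)%R[) (g x)%:E)%E.
Proof.
move=> K0 cg g0.
have mg (D : set (measurableTypeR R)) :
    measurable D -> measurable_fun D (fun x => (g x)%:E).
  move=> mD; apply: measurable_funS measurableT _ _ => //.
  by apply/measurable_EFinP; exact: continuous_measurable_fun.
rewrite integral_uniform; last 2 first.
- exact: mg.
- by move=> x; rewrite lee_fin.
rewrite subr0 invr1 mul1e -integral_itv_bndo_bndc; last exact: mg.
have KR : 0 < K%:R :> R by rewrite ltr0n.
(* Half-open cells are disjoint and concatenate exactly, which permits an induction on the number of
   cells with the mesh 1/K fixed. *)
suff h n : (\int[lebesgue_measure]_(x in `[0%R, (n%:R / K%:R)%R[) (g x)%:E =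
    \sum_(k < n) \int[lebesgue_measure]_(x in
      `[(k%:R / K%:R)%R, (k.+1%:R / K%:R)%R[) (g x)%:E)%E.
  by rewrite -h divff// gt_eqF.
elim: n => [|n IH]; first by
  rewrite mul0r set_itv_ge ?integral_set0 ?big_ord0//= bnd_simp ltxx.
rewrite big_ord_recr /= -IH.
have n0 : 0 <= n%:R / K%:R :> R by rewrite divr_ge0.
have n1 : n%:R / K%:R <= n.+1%:R / K%:R :> R by rewrite ler_pM2r ?invr_gt0// ler_nat.
rewrite -ge0_integral_setU//=.
- by rewrite -itv_bndbnd_setU// bnd_simp.
- by apply: mg; exact: measurableU.
- by move=> x _; rewrite lee_fin.
- apply/disj_setPS => x [] /=; rewrite !in_itv /= => /andP[_ h1] /andP[h2 _].
  by move: (lt_le_trans h1 h2); rewrite ltxx.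
Qed.

Lemma integral_unif_le g K (b : nat -> R) : (0 < K)%N -> continuous g ->
  (forall x, 0 <= g x) ->
  (forall k x, (k < K)%N -> k%:R / K%:R <= x < k.+1%:R / K%:R -> g x <= b k) ->
  (\int[uniform_prob (@ltr01 R)]_x (g x)%:E <= ((\sum_(k < K) b k) / K%:R)%:E)%E.
Proof.
move=> K0 cg g0 gb; have KR : 0 < K%:R :> R by rewrite ltr0n.
have mg (D : set (measurableTypeR R)) :
    measurable D -> measurable_fun D (fun x => (g x)%:E).
  move=> mD; apply: measurable_funS measurableT _ _ => //.
  by apply/measurable_EFinP; exact: continuous_measurable_fun.
rewrite (integral_unif_split K0 cg g0) mulr_suml -sumEFin; apply: lee_sum => k _.
have k1 : k%:R / K%:R < k.+1%:R / K%:R :> R by rewrite ltr_pM2r ?invr_gt0// ltr_nat.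
have b0 : 0 <= b k.
  by apply: le_trans (g0 (k%:R / K%:R)) _; apply: gb => //; rewrite lexx.
apply: (@le_trans _ _ (\int[lebesgue_measure]_(x in
    `[(k%:R / K%:R)%R, (k.+1%:R / K%:R)%R[) (b k)%:E)%E).
  apply: ge0_le_integral => //=; first by move=> x _; rewrite lee_fin.
  + exact: mg.
  + by move=> x; rewrite in_itv/= lee_fin; exact: gb.
rewrite integral_cst//= lebesgue_measure_itv /= lte_fin k1 -EFinD -EFinM lee_fin.
by rewrite -mulrBl -natrB// subSnn mul1r.
Qed.

Lemma integral_unif_ge g K (b : nat -> R) : (0 < K)%N -> continuous g ->
  (forall x, 0 <= g x) ->
  (forall k x, (k < K)%N -> k%:R / K%:R <= x < k.+1%:R / K%:R -> b k <= g x) ->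
  (((\sum_(k < K) b k) / K%:R)%:E <= \int[uniform_prob (@ltr01 R)]_x (g x)%:E)%E.
Proof.
move=> K0 cg g0 gb; have KR : 0 < K%:R :> R by rewrite ltr0n.
have mg (D : set (measurableTypeR R)) :
    measurable D -> measurable_fun D (fun x => (g x)%:E).
  move=> mD; apply: measurable_funS measurableT _ _ => //.
  by apply/measurable_EFinP; exact: continuous_measurable_fun.
rewrite (integral_unif_split K0 cg g0) mulr_suml -sumEFin; apply: lee_sum => k _.
have k1 : k%:R / K%:R < k.+1%:R / K%:R :> R by rewrite ltr_pM2r ?invr_gt0// ltr_nat.
(* The bounds will be sampled values minus an error and may be negative; such a cell is handled by
   the positivity of the integral. *)
have [b0|/ltW b0] := leP 0 (b k); last first.
  apply: (@le_trans _ _ 0%E); last by apply: integral_ge0 => x _; rewrite lee_fin.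
  by rewrite lee_fin mulr_le0_ge0// invr_ge0 ltW.
apply: (@le_trans _ _ (\int[lebesgue_measure]_(x in
    `[(k%:R / K%:R)%R, (k.+1%:R / K%:R)%R[) (b k)%:E)%E).
  rewrite integral_cst//= lebesgue_measure_itv /= lte_fin k1 -EFinD -EFinM lee_fin.
  by rewrite -mulrBl -natrB// subSnn mul1r.
apply: ge0_le_integral => //=.
+ exact: mg.
+ by move=> x; rewrite in_itv/= lee_fin; exact: gb.
Qed.

(** Compactness in the form of [near_covering]: a radius that works around each [x0] for all nearby
    [x] and all small [delta] yields one [delta] for the whole interval. The point [y] is free to
    leave the interval. *)
Lemma uniform_continuity g (a b eps : R) : continuous g -> 0 < eps ->
  exists2 delta, 0 < delta &
  forall x y, a <= x <= b -> `|y - x| < delta -> `|g y - g x| < eps.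
Proof.
move=> cg eps0; have e2 : 0 < eps / 2 by rewrite divr_gt0.
pose P (delta x : R) := forall y, `|y - x| < delta -> `|g y - g x| < eps.
have cover : near_covering `[a, b]%classic.
  by apply/compact_near_coveringP; exact: segment_compact.
have hP x0 : `[a, b]%classic x0 ->
    \forall x \near x0 & delta \near (0 : R)^'+, P delta x.
  move=> _; have /cvgrPdist_lt/(_ _ e2)/nbhs_ballP[d /= d0 hd] := cg x0.
  have d2 : 0 < d / 2 by rewrite divr_gt0.
  exists (ball x0 (d / 2), [set delta | 0 < delta < d / 2]).
    split; first exact: nbhsx_ballx.
    by near=> t; apply/andP; split; near: t;
      [exact: nbhs_right_gt | exact: nbhs_right_lt].
  move=> [x delta] [/= x0x /andP[delta0 deltad] y xy].
  have h1 := hd x (le_ball (ltW (ltac:(lra) : d / 2 < d)) x0x).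
  have h2 : `|g x0 - g y| < eps / 2.
    apply: hd; rewrite /ball /= in x0x *.
    rewrite -(subrK x x0) -addrA; apply: le_lt_trans (ler_normD _ _) _.
    by rewrite [d]splitr ltrD// distrC (lt_trans xy).
  rewrite distrC -(subrK (g x0) (g x)) -addrA; apply: le_lt_trans (ler_normD _ _) _.
  by rewrite [eps]splitr ltrD// distrC.
have [delta [delta0 hdelta]] :=
  filter_ex (filterI (nbhs_right_gt (0 : R)) (cover _ _ P _ hP)).
by exists delta => // x y xab; apply: hdelta; rewrite /= in_itv.
Unshelve. all: by end_near. Qed.

End RiemannSums.

Section CircleMeans.
Context {R : realType}.
Implicit Types (g : R -> R) (eps r s : R) (phi : R[i] -> R[i]).

(** Shifting by 1/K permutes the sample points up to a period, so [x] can be reduced to the first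
    cell. The sum then has one sample in each cell and is a Riemann sum. *)
Lemma sum_shift_periodic g K x : (0 < K)%N -> (forall y, g (y + 1) = g y) ->
  exists2 c, 0 <= c < K%:R^-1 &
  \sum_(k < K) g (x + k%:R / K%:R) = \sum_(k < K) g (c + k%:R / K%:R).
Proof.
move=> K0 g1; have KR : 0 < K%:R :> R by rewrite ltr0n.
pose S x := \sum_(k < K) g (x + k%:R / K%:R).
have S1 y : S (y + K%:R^-1) = S y.
  rewrite /S; case: K K0 KR {S} => // K _ KR.
  rewrite big_ord_recr big_ord_recl /= addrC mul0r addr0; congr (_ + _).
    rewrite -[RHS]g1; congr (g _); rewrite -addrA; congr (_ + _).
    by rewrite -[X in X + _]mul1r -mulrDl addrC natr1 divff// gt_eqF.
  apply: eq_bigr => k _; congr (g _); rewrite -addrA; congr (_ + _).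
  by rewrite -[X in X + _]mul1r -mulrDl addrC natr1 /bump add1n.
have Sn n y : S (y + n%:R / K%:R) = S y.
  elim: n => [|n IH]; first by rewrite mul0r addr0.
  by rewrite -natr1 mulrDl mul1r addrA S1 IH.
pose m := Num.floor (x * K%:R).
have /andP[m1 m2] := Num.Theory.floor_itv (x * K%:R).
exists (x - m%:~R / K%:R).
  rewrite subr_ge0 ler_pdivrMr// m1 /= ltrBlDl -[X in _ + X]mul1r -mulrDl.
  by rewrite ltr_pdivlMr// -intrD1.
rewrite -/(S x) -/(S _); case: m {m1 m2} => n.
  by rewrite -[LHS](Sn n) ; rewrite -[in RHS](Sn n) subrK Sn.
by rewrite NegzE mulrNz mulNr opprK Sn.
Qed.

(** A Riemann sum over the circle of radius [r] is the value at the point [r] of [Phi], a sum of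
    rotated copies of |phi|^2. The maximum principle bounds it by the value of [Phi] at some point
    of the circle of radius [s], which is again a Riemann sum, with shifted sample points. *)
Lemma mean2_nondecreasing phi r s : 0 <= r <= s ->
  (forall z, normc z <= s -> poly_approx_at phi z /\
     eps_continuous_at (fun w => normc (phi w) ^+ 2) z) ->
  (\int[uniform_prob (@ltr01 R)]_t (normc (phi (r%:C * expi (2 * pi * t))) ^+ 2)%:E
   <= \int[uniform_prob (@ltr01 R)]_t (normc (phi (s%:C * expi (2 * pi * t))) ^+ 2)%:E)%E.
Proof.
move=> /andP[r0 rs] hphi; have s0 := le_trans r0 rs.
pose G z := normc (phi z) ^+ 2.
pose g x t := G (x%:C * expi (2 * pi * t)).
have g_ge0 x t : 0 <= g x t by exact: sqr_ge0.
have cg x : 0 <= x <= s -> continuous (g x).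
  move=> /andP[x0 xs] t.
  have cpair : (fun u : R => (x, u)) @ t --> (x, t).
    by apply: (@cvg_pair _ _ _ _ (nbhs x) (nbhs t)) => /=; [exact: cvg_cst | exact: cvg_id].
  apply: (cvg_comp _ _ cpair (continuous_polar (G := G) _)).
  by apply: (hphi _ _).2; rewrite normcM normc_expi normcR mulr1 ger0_norm.
have g1 x t : g x (t + 1) = g x t by rewrite /g mulrDr mulr1 expiD expi_2pi mulr1.
(* Three errors: the oscillation on a cell for either radius, and the loss in the maximum principle,
   taken as K e because the sums are divided by K. *)
apply/lee_addgt0Pr => eps eps0; pose e := eps / 3.
have e0 : 0 < e by rewrite divr_gt0.
have [d1 d10 h1] := uniform_continuity 0 2 (cg r ltac:(by rewrite r0)) e0.
have [d2 d20 h2] := uniform_continuity 0 2 (cg s ltac:(by rewrite s0 lexx)) e0.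
pose d := Num.min d1 d2; have d0 : 0 < d by rewrite lt_min d10.
pose K := (Num.truncn d^-1).+1.
have K0 : (0 < K)%N by [].
have KR : 0 < K%:R :> R by rewrite ltr0n.
have Kd : K%:R^-1 < d.
  by rewrite -[ltRHS]invrK ltf_pV2 ?posrE ?invr_gt0//; exact: Num.Theory.truncnS_gt.
have /andP[Kd1 Kd2] : (K%:R^-1 < d1) && (K%:R^-1 < d2) by move: Kd; rewrite lt_min.
have cell k (x : R) : (k < K)%N -> k%:R / K%:R <= x < k.+1%:R / K%:R -> 0 <= x <= 2.
  move=> kK /andP[kx xk]; apply/andP; split.
    by apply: le_trans kx; rewrite divr_ge0.
  apply: (le_trans (ltW xk)). rewrite ler_pdivrMr//.
  by apply: (@le_trans _ _ K%:R); rewrite ?ler_nat// ler_peMl// ler1n.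
have upper : (\int[uniform_prob (@ltr01 R)]_t (g r t)%:E <=
    ((\sum_(k < K) (g r (k%:R / K%:R) + e)) / K%:R)%:E)%E.
  apply: (@integral_unif_le _ _ K (fun k => g r (k%:R / K%:R) + e)) => //.
    by apply: cg; rewrite r0.
  move=> k x kK kx; have x02 := cell _ _ kK kx.
  have h := h1 x (k%:R / K%:R) x02.
  suff /h : `|k%:R / K%:R - x| < d1 by rewrite ltr_norml => /andP[]; lra.
  move: kx; rewrite -natr1 mulrDl mul1r => /andP[kx1 kx2].
  by rewrite ltr_norml; apply/andP; split; lra.
pose Phi z := \sum_(k < K) G (z * expi (2 * pi * (k%:R / K%:R))).
have hPhi w : normc w <= s -> submean_at Phi w /\ eps_continuous_at Phi w.
  move=> ws; split.
    apply: (@submean_at_sum _ K (fun k z => G (z * expi (2 * pi * (k%:R / K%:R))))) => k _.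
    apply: submean_at_rot; first exact: normc_expi.
    by apply: submean_at_sqr; apply: (hphi _ _).1; rewrite normcM normc_expi mulr1.
  apply: (@eps_continuous_at_sum _ K (fun k z => G (z * expi (2 * pi * (k%:R / K%:R))))) => k _.
  apply: eps_continuous_at_rot; first exact: normc_expi.
  by apply: (hphi _ _).2; rewrite normcM normc_expi mulr1.
have [||t ht] := @max_principle _ Phi s (K%:R * e) r%:C _ _ hPhi.
- by rewrite mulr_gt0.
- by rewrite normcR ger0_norm.
have Phir : Phi r%:C = \sum_(k < K) g r (k%:R / K%:R) by [].
have Phis : Phi (s%:C * expi (2 * pi * t)) = \sum_(k < K) g s (t + k%:R / K%:R).
  by apply: eq_bigr => k _; rewrite -mulrA -expiD -mulrDr.
have [c /andP[c0 cK] tc] := sum_shift_periodic t K0 (g1 s).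
have lower : (((\sum_(k < K) (g s (c + k%:R / K%:R) - e)) / K%:R)%:E <=
    \int[uniform_prob (@ltr01 R)]_t (g s t)%:E)%E.
  apply: (@integral_unif_ge _ _ K (fun k => g s (c + k%:R / K%:R) - e)) => //.
    by apply: cg; rewrite s0 lexx.
  move=> k x kK kx; have x02 := cell _ _ kK kx.
  have h := h2 x (c + k%:R / K%:R) x02.
  suff /h : `|c + k%:R / K%:R - x| < d2 by rewrite ltr_norml => /andP[]; lra.
  move: kx; rewrite -natr1 mulrDl mul1r => /andP[kx1 kx2].
  by rewrite ltr_norml; apply/andP; split; lra.
apply: (le_trans upper); apply: le_trans (leeD2r _ lower).
rewrite -EFinD lee_fin.
rewrite big_split sumrB /= -Phir -tc -Phis !sumr_const card_ord -[e *+ K]mulr_natl.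
rewrite ler_pdivrMr// mulrDl divfK ?gt_eqF//.
have -> : eps = 3 * e by rewrite /e mulrC divfK.
by move: ht; lra.
Qed.

End CircleMeans.

(** * Means over tori *)

Section TupleMeasurability.
Context {R : realType}.
Local Notation T := (measurableTypeR R).

Definition tuple_box n (q : n.-tuple rat) (k : nat) : set (n.-tuple T) :=
  \bigcap_(j in [set: 'I_n])
    ((fun t => tnth t j) @^-1` ball (ratr (tnth q j) : R) (k.+1%:R^-1)).

Lemma measurable_tuple_box n (q : n.-tuple rat) k : measurable (tuple_box q k).
Proof.
apply: fin_bigcap_measurable => // j _.
rewrite -[X in measurable X]setTI; apply: measurable_tnth => //.
exact: measurable_ball.
Qed.

(* An open set of tuples is a countable union of boxes with rational centres. *)
Lemma measurable_tuple_continuous n (h : n.-tuple T -> R) :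
  (forall t eps, 0 < eps -> exists2 delta : R, 0 < delta &
    forall s, (forall j, `|tnth s j - tnth t j| < delta) -> `|h s - h t| < eps) ->
  measurable_fun [set: n.-tuple T] h.
Proof.
move=> ch mD; apply: (measurability _ (RGenOInfty.measurableE R)) => //.
move=> /= _ [_ [a ->] <-]; rewrite setTI preimage_itvoy.
(* Boxes that stick out of the open set are replaced by the empty set, so that the union runs over a
   whole countable type. *)
pose F (x : n.-tuple rat * nat) : set (n.-tuple T) :=
  if pselect (tuple_box x.1 x.2 `<=` [set s | a < h s]) then tuple_box x.1 x.2
  else set0.
rewrite (_ : [set x | _] = \bigcup_x F x).
  apply: countable_bigcupT_measurable => [|x]; first exact: countableP.
  rewrite /F.
  by case: pselect => /= _; [exact: measurable_tuple_box | exact: measurable0].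
apply/seteqP; split => [t /= ht|t [x _]]; last first.
  by rewrite /F; case: pselect => //= sub xt; exact: sub.
have [|delta delta0 hdelta] := ch t (h t - a); first by rewrite subr_gt0.
(* The radius [d] is below [delta] / 2: the box is centred within [d] of [t], so its points are
   within 2 [d] of [t]. *)
pose k := Num.truncn (2 / delta); pose d : R := k.+1%:R^-1.
have d0 : 0 < d by rewrite invr_gt0.
have dd : d + d < delta.
  have : 2 / delta < k.+1%:R by exact: Num.Theory.truncnS_gt.
  rewrite ltr_pdivrMr// -ltr_pdivrMl// => h2; apply: le_lt_trans h2.
  by rewrite -/d mulr_natr mulr2n.
have [q hq] : exists q : n.-tuple rat, forall j, `|ratr (tnth q j) - tnth t j| < d.
  have /choice[q hq] : forall j, exists q, `|ratr q - tnth t j| < d.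
    move=> j; have [|q] := @rat_in_itvoo R (tnth t j - d) (tnth t j + d).
      by rewrite ltrD2l gtrN.
    rewrite in_itv /= => /andP[q1 q2]; exists q.
    by rewrite ltr_norml ltrBlDl q2 ltrBrDl q1.
  by exists (mktuple q) => j; rewrite tnth_mktuple.
exists (q, k) => //; rewrite /F; case: pselect => /= [_ j _|].
  by rewrite /ball /=; exact: hq.
case=> s qs /=; have : `|h s - h t| < h t - a.
  apply: hdelta => j; apply: le_lt_trans dd.
  rewrite -(subrK (ratr (tnth q j)) (tnth s j)) -addrA.
  apply: le_trans (ler_normD _ _) _; rewrite lerD// ?(ltW (hq j))//.
  by have := qs j I; rewrite /ball /= distrC => /ltW.
by rewrite ltr_norml => /andP[+ _]; rewrite opprB ltrBlDr subrK.
Qed.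

End TupleMeasurability.

(** * Splitting off one angle of the torus integral *)

Section IteratedIntegrals.
Context {R : realType}.
Local Notation T := (measurableTypeR R).
Local Notation U := (uniform_prob (@ltr01 R)).

Section Cons.
Context (n : nat) (h : n.+1.-tuple T -> R).
Context (mh : measurable_fun [set: n.+1.-tuple T] h) (h0 : forall t, 0 <= h t).

Lemma measurable_cons_curry :
  measurable_fun [set: T * n.-tuple T] (fun x => (h (tcons x))%:E).
Proof.
apply/measurable_EFinP.
exact: (measurableT_comp mh (@measurable_tcons R n)).
Qed.

Lemma integral_unit_cube_cons :
  (\int[unit_cube_prob n.+1]_t (h t)%:E =
   \int[U]_x \int[unit_cube_prob n]_t (h (tcons (x, t)))%:E)%E.
Proof.
rewrite /= ge0_integral_pushforward//=; last 2 first.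
- exact/measurable_EFinP.
- by move=> t _; rewrite lee_fin.
rewrite preimage_setT fubini_tonelli1//.
- exact: measurable_cons_curry.
- by move=> x; rewrite lee_fin.
Qed.

(** With the head angle innermost, the one-variable monotonicity applies for each fixed tail; the
    other order serves the induction on the tail. *)
Lemma integral_unit_cube_cons_swap :
  (\int[unit_cube_prob n.+1]_t (h t)%:E =
   \int[unit_cube_prob n]_t \int[U]_x (h (tcons (x, t)))%:E)%E.
Proof.
rewrite /= ge0_integral_pushforward//=; last 2 first.
- exact/measurable_EFinP.
- by move=> t _; rewrite lee_fin.
rewrite preimage_setT fubini_tonelli2//.
- exact: measurable_cons_curry.
- by move=> x; rewrite lee_fin.
Qed.

Lemma measurable_integral_unit_cube :
  measurable_fun [set: T] (fun x => \int[unit_cube_prob n]_t (h (tcons (x, t)))%:E)%E.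
Proof.
apply: (@measurable_fun_fubini_tonelli_F _ _ _ _ _ _ (fun x => (h (tcons x))%:E)).
- exact: measurable_cons_curry.
- by move=> x; rewrite lee_fin.
Qed.

Lemma measurable_integral_unif :
  measurable_fun [set: n.-tuple T] (fun t => \int[U]_x (h (tcons (x, t)))%:E)%E.
Proof.
apply: (@measurable_fun_fubini_tonelli_G _ _ _ _ _ _ (fun x => (h (tcons x))%:E)).
- exact: measurable_cons_curry.
- by move=> x; rewrite lee_fin.
Qed.

End Cons.
End IteratedIntegrals.

Section PolycircularMeans.
Context {R : realType}.
Local Notation T := (measurableTypeR R).
Local Notation U := (uniform_prob (@ltr01 R)).
Implicit Types (F : seq R[i] -> R[i]) (a b : seq R[i]) (rho sigma : seq R).

Definition disc_point (z : R[i]) := normc z < 1.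

(** Points are sequences here, so that inductions on [n] can peel off the first coordinate. *)
Definition polydisc_continuous n F := forall a, size a = n -> all disc_point a ->
  forall eps : R, 0 < eps -> exists2 delta : R, 0 < delta &
  forall b, size b = n -> all disc_point b ->
  (forall j, (j < n)%N -> normc (b`_j - a`_j) < delta) -> normc (F b - F a) < eps.

Fixpoint separately_poly n F : Prop :=
  if n is m.+1 then
    (forall b z, size b = m -> all disc_point b -> disc_point z ->
       poly_approx_at (fun w => F (w :: b)) z) /\
    (forall z, disc_point z -> separately_poly m (fun b => F (z :: b)))
  else True.

Definition torus_seq rho (t : seq R) : seq R[i] :=
  [seq p.1%:C * expi (2 * pi * p.2) | p <- zip rho t].

(** Each variable has its own radius: the radii are raised one at a time, and a general point of the
    polydisc has coordinates of different moduli. *)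
Definition polymean n rho F : \bar R :=
  (\int[unit_cube_prob n]_t (normc (F (torus_seq rho t)) ^+ 2)%:E)%E.

Lemma expi_unif_continuous (eps : R) : 0 < eps ->
  exists2 delta : R, 0 < delta & forall x y : R, `|y - x| < delta ->
    normc (expi (2 * pi * y) - expi (2 * pi * x)) < eps.
Proof.
move=> eps0; have e2 : 0 < eps / 2 by rewrite divr_gt0.
have /cvgrPdist_lt/(_ _ e2)/nbhs_ballP[d1 d10 h1] := @continuous_cos R 0.
have /cvgrPdist_lt/(_ _ e2)/nbhs_ballP[d2 d20 h2] := @continuous_sin R 0.
have pi0 : 0 < 2 * pi :> R by rewrite mulr_gt0// pi_gt0.
exists (Num.min d1 d2 / (2 * pi)) => [|x y]; first by rewrite divr_gt0// lt_min d10.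
rewrite ltr_pdivlMr// => xy.
have {xy} : `|2 * pi * (y - x)| < Num.min d1 d2 by rewrite normrM gtr0_norm// mulrC.
set u := 2 * pi * (y - x); rewrite lt_min => /andP[u1 u2].
have -> : expi (2 * pi * y) - expi (2 * pi * x) = expi (2 * pi * x) * (expi u - 1).
  by rewrite mulrBr mulr1 -expiD; congr (expi _ - _); rewrite /u; ring.
rewrite normcM normc_expi mul1r; apply: le_lt_trans (normc_le_ReIm _) _.
rewrite /= oppr0 addr0 [eps]splitr ltrD//.
- have := h1 u; rewrite /= cos0 distrC; apply.
  by rewrite /ball /= sub0r normrN.
- have := h2 u; rewrite /= sin0 sub0r normrN; apply.
  by rewrite /ball /= sub0r normrN.
Qed.

Lemma size_torus_seq n rho (t : n.-tuple R) : size rho = n ->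
  size (torus_seq rho t) = n.
Proof. by move=> sr; rewrite size_map size_zip sr size_tuple minnn. Qed.

Lemma nth_torus_seq n rho (t : n.-tuple R) j : size rho = n -> (j < n)%N ->
  (torus_seq rho t)`_j = (rho`_j)%:C * expi (2 * pi * t`_j).
Proof.
move=> sr jn; rewrite (nth_map (0, 0)) ?size_zip ?sr ?size_tuple ?minnn//.
by rewrite nth_zip ?sr ?size_tuple.
Qed.

Definition unit_radius (r : R) := 0 <= r < 1.

Lemma all_torus_seq rho (t : seq R) : all unit_radius rho ->
  all disc_point (torus_seq rho t).
Proof.
elim: rho t => [|r rho IH] [|x t] //= /andP[/andP[r0 r1] /IH ->].
by rewrite andbT /disc_point normcM normc_expi normcR mulr1 ger0_norm.
Qed.

Lemma measurable_normc_torus n rho F : size rho = n -> all unit_radius rho ->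
  polydisc_continuous n F ->
  measurable_fun [set: n.-tuple T] (fun t => normc (F (torus_seq rho t)) ^+ 2).
Proof.
move=> sr rho1 cF; apply: measurable_tuple_continuous => t eps eps0.
have [d1 d10 h1] := normc_sqr_continuous (F (torus_seq rho t)) eps0.
have [d2 d20 h2] := cF _ (size_torus_seq t sr) (all_torus_seq t rho1) _ d10.
have [d3 d30 h3] := expi_unif_continuous d20.
exists d3 => // s st; apply: h1; apply: h2; first exact: size_torus_seq.
  exact: all_torus_seq.
move=> j jn; rewrite !nth_torus_seq// -mulrBr normcM.
have /(allP rho1)/andP[r0 r1] : rho`_j \in rho by rewrite mem_nth ?sr.
have : normc (expi (2 * pi * s`_j) - expi (2 * pi * t`_j)) < d2.
  by apply: h3; have := st (Ordinal jn); rewrite !(tnth_nth 0).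
rewrite normcR ger0_norm//; apply: le_lt_trans.
by rewrite ler_piMl ?normc_ge0// ltW.
Qed.

Lemma polydisc_continuous_cons n F z : disc_point z ->
  polydisc_continuous n.+1 F -> polydisc_continuous n (fun b => F (z :: b)).
Proof.
move=> z1 cF a sa a1 eps eps0.
have [||d d0 hd] := cF (z :: a) _ _ _ eps0; [by rewrite /= sa | by rewrite /= z1|].
exists d => // b sb b1 ba; apply: hd => /=; first by rewrite sb.
  by rewrite z1.
by case=> [_|j /ba//]; rewrite /= subrr normc0.
Qed.

Lemma eps_continuous_at_head n F b z : size b = n -> all disc_point b ->
  disc_point z -> polydisc_continuous n.+1 F ->
  eps_continuous_at (fun w => normc (F (w :: b)) ^+ 2) z.
Proof.
move=> sb b1 z1 cF eps eps0.
have [d1 d10 h1] := normc_sqr_continuous (F (z :: b)) eps0.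
have [||d2 d20 h2] := cF (z :: b) _ _ _ d10; [by rewrite /= sb | by rewrite /= z1|].
exists (Num.min d2 (1 - normc z)) => [|w]; first by rewrite lt_min d20 subr_gt0.
rewrite lt_min => /andP[w1 w2]; apply: h1; apply: h2; rewrite /= ?sb//.
  rewrite b1 andbT /disc_point; apply: le_lt_trans (normc_sub_le w z) _.
  by rewrite -ltrBrDl.
by case=> [_//|j _]; rewrite /= subrr normc0.
Qed.

Lemma polymean_cons n r rho F : size rho = n -> all unit_radius (r :: rho) ->
  polydisc_continuous n.+1 F ->
  polymean n.+1 (r :: rho) F =
  (\int[U]_x polymean n rho (fun b => F ((r%:C * expi (2 * pi * x))%R :: b)))%E.
Proof.
move=> sr rho1 cF; rewrite /polymean integral_unit_cube_cons//.
- by apply: measurable_normc_torus => //=; rewrite sr.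
- by move=> t; exact: sqr_ge0.
Qed.

(** The mean with head radius [r] and tail [sigma] lies in between: the induction hypothesis raises
    the tail radii under the integral over the head angle, then [mean2_nondecreasing] raises the
    head radius for each fixed tail. *)
Lemma le_polymean n rho sigma F : size rho = n -> size sigma = n ->
  polydisc_continuous n F -> separately_poly n F ->
  all2 (fun r s => 0 <= r <= s) rho sigma -> all (fun s => s < 1) sigma ->
  (polymean n rho F <= polymean n sigma F)%E.
Proof.
elim: n rho sigma F => [|n IH] [|r rho] [|s sigma] F //= [sr] [ss] cF [F1 F2].
move=> /andP[/andP[r0 rs] rho_sigma] /andP[s1 sigma1].
have sigma_unit : all unit_radius sigma.
  apply/(all_nthP 0) => j js; apply/andP; split; last exact: (all_nthP 0 sigma1).
  have := rho_sigma; rewrite all2E => /andP[_ /(all_nthP (0, 0))/(_ j)].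
  rewrite size_zip sr ss minnn -{1}ss => /(_ js); rewrite nth_zip ?sr ?ss//=.
  by move=> /andP[]; exact: le_trans.
have rho_unit : all unit_radius rho.
  apply/(all_nthP 0) => j js.
  have := rho_sigma; rewrite all2E => /andP[_ /(all_nthP (0, 0))/(_ j)].
  rewrite size_zip sr ss minnn -{1}sr => /(_ js); rewrite nth_zip ?sr ?ss//=.
  move=> /andP[r0' rs']; rewrite /unit_radius r0' (le_lt_trans rs')//.
  by apply: (all_nthP 0 sigma1); rewrite ss -sr.
have r1 : unit_radius r by rewrite /unit_radius r0 (le_lt_trans rs).
have s1' : unit_radius s by rewrite /unit_radius s1 (le_trans r0).
have ge0 v w (t : seq R) : 0 <= normc (F (torus_seq (v :: w) t)) ^+ 2 by exact: sqr_ge0.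
have disc_r x : disc_point (r%:C * expi (2 * pi * x)).
  by rewrite /disc_point normcM normc_expi normcR mulr1 ger0_norm//; case/andP: r1.
have mF v w : unit_radius v -> all unit_radius w -> size w = n ->
    measurable_fun [set: n.+1.-tuple T] (fun t => normc (F (torus_seq (v :: w) t)) ^+ 2).
  by move=> v1 w1 sw; apply: measurable_normc_torus => //=; rewrite ?sw ?v1.
apply: (@le_trans _ _ (polymean n.+1 (r :: sigma) F)).
  rewrite !polymean_cons//= ?r1 ?rho_unit//.
  apply: ge0_le_integral => //.
  - by move=> x _; apply: integral_ge0 => t _; rewrite lee_fin sqr_ge0.
  - exact: (measurable_integral_unit_cube (mF r rho r1 rho_unit sr)).
  - exact: (measurable_integral_unit_cube (mF r sigma r1 sigma_unit ss)).
  - move=> x _; apply: IH => //; first exact: polydisc_continuous_cons.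
    exact: F2.
rewrite /polymean !integral_unit_cube_cons_swap//; last 2 first.
- exact: mF.
- exact: mF.
apply: ge0_le_integral => //.
- by move=> x _; apply: integral_ge0 => t _; rewrite lee_fin sqr_ge0.
- exact: (measurable_integral_unif (mF r sigma r1 sigma_unit ss)).
- exact: (measurable_integral_unif (mF s sigma s1' sigma_unit ss)).
- move=> t _; apply: (@mean2_nondecreasing _ (fun z => F (z :: torus_seq sigma t))).
    by rewrite r0.
  move=> z zs; have z1 : disc_point z by exact: le_lt_trans zs s1.
  split; first by apply: F1 => //; [exact: size_torus_seq | exact: all_torus_seq].
  by apply: (@eps_continuous_at_head n) => //; [exact: size_torus_seq | exact: all_torus_seq].
Qed.

(** If [F] were non-zero at head angle [x0], it would by continuity stay so on an interval of head
    angles with the same tail. But the tail mean is zero for almost every head angle, and there the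
    induction hypothesis makes [F] vanish. *)
Lemma polymean_eq0 n rho F : size rho = n -> all unit_radius rho ->
  polydisc_continuous n F -> polymean n rho F = 0 ->
  forall t : n.-tuple R, (forall j, 0 <= tnth t j <= 1) -> F (torus_seq rho t) = 0.
Proof.
elim: n rho F => [|n IH] rho F sr rho1 cF mean0 t t01.
  have mF : measurable_fun [set: 0.-tuple T]
      (fun t => (normc (F (torus_seq rho t)) ^+ 2)%:E).
    by apply/measurable_EFinP; exact: measurable_normc_torus.
  move: mean0; rewrite /polymean /= integral_dirac// diracE in_setT mul1e.
  move=> /eqP; rewrite eqe expf_eq0 /= normc_eq0 => /eqP.
  by rewrite (tuple0 t).
case: rho sr rho1 mean0 => [//|r rho] /= [sr] /andP[r1 rho1].
rewrite polymean_cons//= ?r1 ?rho1// => mean0.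
have disc_r x : disc_point (r%:C * expi (2 * pi * x)).
  by rewrite /disc_point normcM normc_expi normcR mulr1 ger0_norm//; case/andP: r1.
pose f x := polymean n rho (fun b => F ((r%:C * expi (2 * pi * x)) :: b)).
have f0 x : (0 <= f x)%E by apply: integral_ge0 => s _; rewrite lee_fin sqr_ge0.
have mf : measurable_fun [set: T] f.
  apply: (@measurable_integral_unit_cube _ _ (fun t => normc (F (torus_seq (r :: rho) t)) ^+ 2)).
  + by apply: measurable_normc_torus => //=; rewrite ?sr ?r1.
  + by move=> s; exact: sqr_ge0.
case/tupleP: t t01 => x0 t t01.
have x01 : 0 <= x0 <= 1 by have := t01 ord0; rewrite tnth0.
have t01' j : 0 <= tnth t j <= 1 by have := t01 (lift ord0 j); rewrite tnthS.
rewrite [LHS](_ : _ = F ((r%:C * expi (2 * pi * x0)) :: torus_seq rho t))//.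
apply/eqP; rewrite -normc_eq0; apply: contraT => Fx0.
have Fgt : 0 < normc (F ((r%:C * expi (2 * pi * x0)) :: torus_seq rho t)).
  by rewrite lt_neqAle eq_sym Fx0 normc_ge0.
have [||d d0 hd] := cF ((r%:C * expi (2 * pi * x0)) :: torus_seq rho t) _ _ _ Fgt.
- by rewrite /= size_torus_seq.
- by rewrite /= disc_r all_torus_seq.
have [e e0 he] := expi_unif_continuous d0.
have Fneq x : `|x - x0| < e -> F ((r%:C * expi (2 * pi * x)) :: torus_seq rho t) != 0.
  move=> xe; apply: contraTneq isT => Fx.
  have := hd ((r%:C * expi (2 * pi * x)) :: torus_seq rho t); rewrite Fx sub0r normc_opp ltxx.
  apply; rewrite /= ?size_torus_seq ?disc_r ?all_torus_seq//.
  case=> [_|j _]; last by rewrite /= subrr normc0.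
  rewrite -[X in normc X]/(r%:C * expi (2 * pi * x) - r%:C * expi (2 * pi * x0)).
  rewrite -mulrBr normcM normcR; apply: le_lt_trans (he _ _ xe).
  by case/andP: r1 => r0 r1; rewrite ger0_norm// ler_piMl ?normc_ge0// ltW.
(* The interval is cut down to [0, 1], where the uniform measure lives; it keeps a positive length
   because [x0] belongs to [0, 1]. *)
pose u := Num.max 0 (x0 - e); pose v := Num.min 1 (x0 + e).
have uv : u < v.
  rewrite /u /v gt_max !lt_min ltr01 /=; case/andP: x01 => x00 x01.
  by apply/andP; split; [| apply/andP; split]; lra.
have : (\int[lebesgue_measure]_(x in `[0%R, 1%R]) `|f x| = 0)%E.
  move: mean0; rewrite integral_uniform// subr0 invr1 mul1e => <-.
  by apply: eq_integral => x _; rewrite gee0_abs.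
move=> /ae_eq_integral_abs[//||N [mN N0 subN]].
  exact: measurable_funS mf.
have : (lebesgue_measure `]u, v[ <= lebesgue_measure N)%E.
  apply: le_measure; rewrite ?inE//; apply: subset_trans subN => x.
  rewrite /= in_itv/= /u /v gt_max lt_min => /andP[/andP[x0' x1] /andP[x2 x3]].
  move=> h; have fx0 : f x = 0 by apply: h; rewrite in_itv/= !ltW.
  have /eqP := IH _ _ sr rho1 (polydisc_continuous_cons (disc_r x) cF) fx0 t t01'.
  by apply/negP/Fneq; rewrite ltr_norml; apply/andP; split; lra.
by rewrite N0 lebesgue_measure_itv /= lte_fin uv -EFinD lee_fin subr_le0 leNgt uv.
Qed.

End PolycircularMeans.

(** * Analytic functions on the polydisc *)

Section PowerSeriesTails.
Context {R : realType}.

Lemma partial_sum_tail (A : nat -> R) (E : R) : (forall k, 0 <= A k) ->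
  (forall M, \sum_(0 <= k < M) A k <= E) ->
  forall eps : R, 0 < eps -> exists N, forall M, (N <= M)%N ->
  \sum_(N <= k < M) A k <= eps.
Proof.
move=> A0 AE eps eps0; pose D := [set \sum_(0 <= k < M) A k | M in [set: nat]].
have supD : has_sup D.
  split; first by exists (\sum_(0 <= k < 0) A k), 0%N.
  by exists E => _ [M _ <-].
have [_ [N _ <-] hN] := sup_adherent eps0 supD.
exists N => M NM; have : \sum_(0 <= k < M) A k <= sup D.
  by apply: sup_upper_bound => //; exists M.
rewrite (big_cat_nat (leq0n N) NM)/= => h; rewrite -(lerD2l (\sum_(0 <= k < N) A k)).
by apply: (le_trans h); rewrite -lerBlDr ltW.
Qed.

Definition multi_index_layer n k : seq ('I_n -> nat) :=
  [seq (fun j => nat_of_ord (alpha j)) | alpha : {ffun 'I_n -> 'I_k.+1}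
     <- enum [pred alpha : {ffun 'I_n -> 'I_k.+1} | (\sum_j alpha j == k)%N]].

Lemma sum_multi_index_layer n k alpha : alpha \in multi_index_layer n k ->
  (\sum_j alpha j = k)%N.
Proof. by move=> /mapP[beta]; rewrite mem_enum inE => /eqP h ->. Qed.

Lemma uniq_multi_index_layers n M :
  uniq (flatten [seq multi_index_layer n k | k <- index_iota 0 M]).
Proof.
elim: M => [|M IH]; first by [].
rewrite /index_iota subn0 -addn1 iotaD map_cat flatten_cat /= cats0 add0n.
rewrite cat_uniq; apply/and3P; split; first by move: IH; rewrite /index_iota subn0.
  apply/hasPn => alpha /sum_multi_index_layer sM; apply/negP.
  move=> /flattenP[_ /mapP[k + ->] /sum_multi_index_layer sk].
  by rewrite mem_iota add0n /= -sk sM ltnn.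
rewrite map_inj_uniq ?enum_uniq// => a b ab.
by apply/ffunP => j; apply/val_inj; exact: (congr1 (@^~ j) ab).
Qed.

(** [\esum] is a supremum over finite sets, and the layers up to degree [M] list a finite set
    without repetition, the degree being determined by the multi-index. *)
Lemma layer_sum_le_esum n (a : ('I_n -> nat) -> R) M : (forall alpha, 0 <= a alpha) ->
  ((\sum_(0 <= k < M) \sum_(alpha : {ffun 'I_n -> 'I_k.+1} | (\sum_j alpha j == k)%N)
     a (fun j => alpha j))%:E <= \esum_(alpha in [set: 'I_n -> nat]) (a alpha)%:E)%E.
Proof.
move=> a0; set L := flatten [seq multi_index_layer n k | k <- index_iota 0 M].
apply: esum_ge; exists [set` L].
  by split; [exact: finite_seq | ].
rewrite -fsbig_seq ?uniq_multi_index_layers// sumEFin lee_fin.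
rewrite /L big_flatten big_map le_eqVlt; apply/orP; left; apply/eqP.
by apply: eq_bigr => k _; rewrite big_map big_enum.
Qed.

Lemma normc_monomial_le n (alpha : 'I_n -> nat) (u : 'rV[R[i]]_n) (rho : R) :
  (forall j, normc (u ord0 j) <= rho) ->
  normc (monomial alpha u) <= rho ^+ (\sum_j alpha j)%N.
Proof.
move=> urho; rewrite /monomial normc_prod expr_sum.
apply: ler_prod => j _; rewrite normc_ge0 normcX.
by rewrite lerXn2r ?nnegrE ?normc_ge0// (le_trans (normc_ge0 _) (urho j)).
Qed.

Definition power_partial_sum n (c : ('I_n -> nat) -> R[i]) N (u : 'rV[R[i]]_n) : R[i] :=
  \sum_(0 <= k < N) homogeneous_part c k u.

(** The Weierstrass M-test: absolute convergence at polyradius [rho] bounds the tails independently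
    of [w], which upgrades pointwise to uniform convergence. *)
Lemma analytic_at_approx n (f : polydisc R n -> R[i]) (a : polydisc R n) :
  analytic_at f a -> exists2 rho : R, 0 < rho &
  exists c, forall eps : R, 0 < eps -> exists N, forall w : polydisc R n,
    (forall j, normc (val w ord0 j - val a ord0 j) < rho) ->
    normc (f w - power_partial_sum c N (val w - val a)) <= eps.
Proof.
move=> [rho [c [rho0 cfin fcvg]]]; exists rho => //; exists c => eps eps0.
pose b (alpha : 'I_n -> nat) := normc (c alpha) * rho ^+ (\sum_j alpha j)%N.
have b0 alpha : 0 <= b alpha by rewrite mulr_ge0 ?normc_ge0// exprn_ge0// ltW.
pose A k := \sum_(alpha : {ffun 'I_n -> 'I_k.+1} | (\sum_j alpha j == k)%N)
  b (fun j => alpha j).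
have A0 k : 0 <= A k by apply: sumr_ge0.
have efin : (\esum_(alpha in [set: 'I_n -> nat]) (b alpha)%:E \is a fin_num)%E.
  by rewrite ge0_fin_numE// esum_ge0// => alpha _; rewrite lee_fin.
have [|N hN] := @partial_sum_tail A
    (fine (\esum_(alpha in [set: 'I_n -> nat]) (b alpha)%:E)) A0 _ _ eps0.
  by move=> M; rewrite -lee_fin fineK//; exact: layer_sum_le_esum.
exists N => w wa; apply/ler_addgt0Pl => e e0.
have hA k : normc (homogeneous_part c k (val w - val a)) <= A k.
  apply: le_trans (normc_sum _ _ _) _; apply: ler_sum => alpha _.
  rewrite normcM ler_wpM2l ?normc_ge0//; apply: normc_monomial_le => j.
  by rewrite !mxE ltW.
have /cvgrPdist_lt/(_ _ e0)[M _ hM] := fcvg _ wa.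
pose K := maxn N M.
have := hM K (leq_maxr _ _); rewrite /= sub0r normrN ger0_norm ?normc_ge0// => hK.
apply: le_trans (normc_sub_trans (power_partial_sum c K (val w - val a)) _ _) _.
rewrite lerD//; first by rewrite normcBC ltW.
rewrite /power_partial_sum (big_cat_nat (leq0n N) (leq_maxl N M))/= addrAC subrr add0r.
by apply: le_trans (normc_sum _ _ _) _; apply: le_trans (hN _ (leq_maxl N M)); exact: ler_sum.
Qed.

Lemma normc_monomial_sub0 n (alpha : 'I_n -> nat) (u : 'rV[R[i]]_n) (delta : R) :
  0 <= delta <= 1 -> (forall j, normc (u ord0 j) <= delta) ->
  normc (monomial alpha u - monomial alpha 0) <= delta.
Proof.
move=> /andP[d0 d1] ud.
(* A monomial is either constant or divisible by some coordinate; as [delta] is at most 1, a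
   positive power of it is at most [delta]. *)
have [[j0 aj0]|alpha0] := pselect (exists j, (0 < alpha j)%N); last first.
  have E v : monomial alpha v = 1.
    rewrite /monomial big1// => j _; case: (posnP (alpha j)) => [->//|aj].
    by case: alpha0; exists j.
  by rewrite !E subrr normc0.
have -> : monomial alpha (0 : 'rV[R[i]]_n) = 0.
  by rewrite /monomial (bigD1 j0)//= mxE expr0n gtn_eqF// mul0r.
rewrite subr0; apply: le_trans (normc_monomial_le alpha ud) _.
rewrite -[leRHS]expr1 ler_wiXn2l//.
by rewrite (bigD1 j0)//= (leq_trans aj0)// leq_addr.
Qed.

(** Continuity at 0 suffices, since at each point the expansion centred there is used. *)
Lemma power_partial_sum_continuous0 n (c : ('I_n -> nat) -> R[i]) N (eps : R) :
  0 < eps -> exists2 delta : R, 0 < delta & forall u : 'rV[R[i]]_n,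
  (forall j, normc (u ord0 j) <= delta) ->
  normc (power_partial_sum c N u - power_partial_sum c N 0) <= eps.
Proof.
move=> eps0; pose M := \sum_(0 <= k < N)
  \sum_(alpha : {ffun 'I_n -> 'I_k.+1} | (\sum_j alpha j == k)%N)
  normc (c (fun j => alpha j)).
have M0 : 0 <= M by do 2!apply: sumr_ge0 => ? _; exact: normc_ge0.
have M1 : 0 < M + 1 by rewrite ltr_wpDl.
pose delta := Num.min 1 (eps / (M + 1)).
have d0 : 0 < delta by rewrite lt_min ltr01 divr_gt0.
have d1 : delta <= 1 by rewrite ge_min lexx.
exists delta => // u ud.
have : M * delta <= eps.
  apply: (@le_trans _ _ ((M + 1) * delta)); first by rewrite ler_pM2r// lerDl.
  by rewrite -ler_pdivlMl// mulrC ge_min lexx orbT.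
apply: le_trans; rewrite /power_partial_sum -sumrB.
apply: le_trans (normc_sum _ _ _) _; rewrite mulr_suml; apply: ler_sum => k _.
rewrite /homogeneous_part -sumrB.
apply: le_trans (normc_sum _ _ _) _; rewrite mulr_suml; apply: ler_sum => alpha _.
rewrite -mulrBr normcM ler_wpM2l ?normc_ge0// normc_monomial_sub0//.
by rewrite ltW.
Qed.

Lemma analytic_at_continuous n (f : polydisc R n -> R[i]) (a : polydisc R n) :
  analytic_at f a -> forall eps : R, 0 < eps -> exists2 delta : R, 0 < delta &
  forall w : polydisc R n, (forall j, normc (val w ord0 j - val a ord0 j) < delta) ->
  normc (f w - f a) < eps.
Proof.
move=> /analytic_at_approx[rho rho0 [c happ]] eps eps0.
have e4 : 0 < eps / 4 by rewrite divr_gt0.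
have [N hN] := happ _ e4.
have [d d0 hd] := power_partial_sum_continuous0 c N e4.
exists (Num.min rho d) => [|w wa]; first by rewrite lt_min rho0.
have w1 : normc (f w - power_partial_sum c N (val w - val a)) <= eps / 4.
  by apply: hN => j; have := wa j; rewrite lt_min => /andP[].
have w2 : normc (f a - power_partial_sum c N 0) <= eps / 4.
  rewrite -[0](subrr (val a)); apply: hN => j.
  by rewrite subrr normc0.
have w3 : normc (power_partial_sum c N (val w - val a) - power_partial_sum c N 0) <= eps / 4.
  by apply: hd => j; rewrite !mxE; have := wa j; rewrite lt_min => /andP[_ /ltW].
have := normc_sub_trans (power_partial_sum c N (val w - val a)) (f w) (f a).
have := normc_sub_trans (power_partial_sum c N 0) (power_partial_sum c N (val w - val a)) (f a).
by move: w2; rewrite normcBC; lra.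
Qed.

End PowerSeriesTails.

(** * From points of the polydisc to sequences of coordinates *)

Section SequenceCoordinates.
Context {R : realType}.
Implicit Types (s a b : seq R[i]).

Definition seqfun n (f : polydisc R n -> R[i]) s : R[i] :=
  extend0 f (\row_(j < n) s`_j).

Lemma in_polydisc_seq n s : size s = n -> all disc_point s ->
  in_polydisc (\row_(j < n) s`_j).
Proof.
move=> sn s1; apply/forallP => j; rewrite mxE.
by apply: (all_nthP 0 s1); rewrite sn.
Qed.

Definition polydisc_point n (z : 'rV[R[i]]_n) (z1 : in_polydisc z) : polydisc R n :=
  exist (fun z => is_true (in_polydisc z)) z z1.

Lemma extend0E n (f : polydisc R n -> R[i]) z (z1 : in_polydisc z) :
  extend0 f z = f (polydisc_point z1).
Proof. by rewrite /extend0 insubT. Qed.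

Lemma circle_mean2_polymean n (f : polydisc R n -> R[i]) r :
  circle_mean2 f r = polymean n (nseq n r) (seqfun f).
Proof.
apply: eq_integral => t _; congr (normc (extend0 f _) ^+ 2)%:E.
apply/rowP => j; rewrite !mxE nth_torus_seq ?size_nseq//.
by rewrite nth_nseq ltn_ord (tnth_nth 0).
Qed.

Lemma seqfun_continuous n (f : polydisc R n -> R[i]) : analytic f ->
  polydisc_continuous n (seqfun f).
Proof.
move=> af a sa a1 eps eps0; pose a' := polydisc_point (in_polydisc_seq sa a1).
have [d d0 hd] := analytic_at_continuous (af a') eps0.
exists d => // b sb b1 ba.
rewrite /seqfun !(extend0E _ (in_polydisc_seq sa a1)) (extend0E _ (in_polydisc_seq sb b1)).
by apply: hd => j /=; rewrite !mxE; exact: ba.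
Qed.

(** Unrolls the recursion: the moving variable sits between a frozen prefix [a] and a frozen suffix
    [b]. *)
Lemma separately_poly_intro n F :
  (forall a b z, (size a + (size b).+1 = n)%N -> all disc_point a ->
     all disc_point b -> disc_point z ->
     poly_approx_at (fun w => F (a ++ w :: b)) z) ->
  separately_poly n F.
Proof.
elim: n F => [|n IH] F hF //=; split => [b z sb b1 z1|z z1].
  by apply: (hF [::]) => //; rewrite /= sb.
apply: IH => a b w sab a1 b1 w1; apply: (hF (z :: a)) => //=; first by rewrite addSn sab.
by rewrite a1 andbT.
Qed.

Lemma power_partial_sum_poly n (c : ('I_n -> nat) -> R[i]) N (j0 : nat) z :
  exists p : {poly R[i]}, forall w,
    power_partial_sum c N (\row_(j < n) (if j == j0 :> nat then w - z else 0)) = p.[w].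
Proof.
pose P (j : 'I_n) : {poly R[i]} := if j == j0 :> nat then 'X - z%:P else 0.
exists (\sum_(0 <= k < N) \sum_(alpha : {ffun 'I_n -> 'I_k.+1} | (\sum_j alpha j == k)%N)
  (c (fun j => alpha j))%:P * \prod_j P j ^+ alpha j) => w.
rewrite horner_sum; apply: eq_bigr => k _.
rewrite horner_sum; apply: eq_bigr => alpha _.
rewrite hornerM hornerC; congr (_ * _).
rewrite horner_prod; apply: eq_bigr => j _.
by rewrite horner_exp mxE /P; case: eqP => _; rewrite !hornerE.
Qed.

Lemma seqfun_separately_poly n (f : polydisc R n -> R[i]) : analytic f ->
  separately_poly n (seqfun f).
Proof.
move=> af; apply: separately_poly_intro => a b z sab a1 b1 z1.
have in_w w : disc_point w -> in_polydisc (\row_(j < n) (a ++ w :: b)`_j).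
  by move=> w1; apply: in_polydisc_seq; rewrite ?size_cat// all_cat a1 /= w1.
pose z' := polydisc_point (in_w z z1).
have [rho rho0 [c happ]] := analytic_at_approx (af z').
(* The second bound keeps the moving coordinate in the unit disc, where [seqfun f] is given by [f]
   and not by its default value. *)
exists (Num.min rho (1 - normc z)) => [|eps eps0]; first by rewrite lt_min rho0 subr_gt0.
have [N hN] := happ _ eps0.
have [p hp] := power_partial_sum_poly c N (size a) z.
exists p => w; rewrite lt_min => /andP[wrho w1].
have {}w1 : disc_point w.
  by rewrite /disc_point; apply: le_lt_trans (normc_sub_le w z) _; rewrite -ltrBrDl.
have E : \row_(j < n) (a ++ w :: b)`_j - \row_(j < n) (a ++ z :: b)`_j
    = \row_(j < n) (if j == size a :> nat then w - z else 0).
  apply/rowP => j; rewrite !mxE !nth_cat; case: ltngtP => [ja|ja|->].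
  - by rewrite subrr.
  - by rewrite -(subnSK ja) /= subrr.
  - by rewrite subnn.
rewrite /seqfun (extend0E _ (in_w w w1)) -hp -E.
apply: (hN (polydisc_point (in_w w w1))) => j.
have /rowP/(_ j) := E; rewrite !mxE /= => ->.
by case: eqP => // _; rewrite normc0.
Qed.

End SequenceCoordinates.

(** * The norm and the inner product of the Hardy space *)

Section HardySquaredNorm.
Context {R : realType} {n : nat}.
Local Notation T := (measurableTypeR R).
Implicit Types (f g : polydisc R n -> R[i]) (r s : R).

(** This is literally the term summed in [hardy_inner], so polarisation unfolds to it. *)
Definition hardy_sqn f : R := fine (hardy_norm f) ^+ 2.

Lemma circle_mean2_ge0 f r : (0 <= circle_mean2 f r)%E.
Proof. by apply: integral_ge0 => t _; rewrite lee_fin sqr_ge0. Qed.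

Lemma all_unit_nseq r : unit_radius r -> all unit_radius (nseq n r).
Proof. by move=> r1; rewrite all_nseq r1 orbT. Qed.

Lemma measurable_circle f r : analytic f -> unit_radius r ->
  measurable_fun [set: n.-tuple T]
    (fun t => normc (extend0 f (torus_point r t)) ^+ 2).
Proof.
move=> af r1.
have := @measurable_normc_torus R n (nseq n r) (seqfun f) (size_nseq _ _)
  (all_unit_nseq r1) (seqfun_continuous af).
congr (measurable_fun _ _); apply/funext => t; congr (normc (extend0 f _) ^+ 2).
apply/rowP => j; rewrite !mxE nth_torus_seq ?size_nseq//.
by rewrite nth_nseq ltn_ord (tnth_nth 0).
Qed.

Lemma circle_mean2_le f r s : analytic f -> 0 <= r <= s -> s < 1 ->
  (circle_mean2 f r <= circle_mean2 f s)%E.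
Proof.
move=> af rs s1; rewrite !circle_mean2_polymean; apply: le_polymean.
- exact: size_nseq.
- exact: size_nseq.
- exact: seqfun_continuous.
- exact: seqfun_separately_poly.
- by elim: n => //= m ->; rewrite rs.
- by rewrite all_nseq s1 orbT.
Qed.

Lemma hardy_norm_ge0 f : (0 <= hardy_norm f)%E.
Proof.
apply: (@le_trans _ _ ((circle_mean2 f 0) `^ 2^-1)%E); first exact: poweR_ge0.
by apply: ereal_sup_ubound; exists 0; rewrite //= in_itv/= lexx ltr01.
Qed.

Lemma hardy_norm_fin f : hardy f -> (hardy_norm f \is a fin_num)%E.
Proof. by move=> [_ foo]; rewrite ge0_fin_numE// hardy_norm_ge0. Qed.

Lemma circle_mean2_le_sqn f r : hardy f -> unit_radius r ->
  (circle_mean2 f r <= (hardy_sqn f)%:E)%E.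
Proof.
move=> hf r1; have := hardy_norm_fin hf; rewrite /hardy_sqn.
have : (circle_mean2 f r `^ 2^-1 <= hardy_norm f)%E.
  by apply: ereal_sup_ubound; exists r => //=; rewrite in_itv.
have := circle_mean2_ge0 f r.
case: (circle_mean2 f r) => [m| |]; case: (hardy_norm f) => [N| |]//=.
  rewrite ?poweR_EFin !lee_fin => m0; rewrite powR12_sqrt// => mN _.
  by rewrite -(sqr_sqrtr m0) lerXn2r// nnegrE ?sqrtr_ge0// (le_trans (sqrtr_ge0 _) mN).
by rewrite gt_eqF// invr_gt0.
Qed.

Lemma circle_mean2_fin f r : hardy f -> unit_radius r ->
  (circle_mean2 f r \is a fin_num)%E.
Proof.
move=> hf r1; rewrite ge0_fin_numE ?circle_mean2_ge0//.
exact: le_lt_trans (circle_mean2_le_sqn hf r1) (ltry _).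
Qed.

Lemma hardy_sqn_le f (b : R) : hardy f ->
  (forall r, unit_radius r -> (circle_mean2 f r <= b%:E)%E) -> hardy_sqn f <= b.
Proof.
move=> hf hb; have b0 : 0 <= b.
  rewrite -lee_fin; apply: le_trans (circle_mean2_ge0 f 0) (hb 0 _).
  by rewrite /unit_radius lexx ltr01.
have : (hardy_norm f <= (Num.sqrt b)%:E)%E.
  apply: ge_ereal_sup => _ [r /= r1 <-].
  have {}r1 : unit_radius r by move: r1; rewrite in_itv.
  have := hb _ r1; have := circle_mean2_ge0 f r.
  case: (circle_mean2 f r) => [m| |]//=; rewrite ?poweR_EFin !lee_fin => m0 mb.
  by rewrite powR12_sqrt// ler_sqrt.
have N0 := hardy_norm_ge0 f.
rewrite /hardy_sqn; move: N0; have := hardy_norm_fin hf.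
case: (hardy_norm f) => //= N _; rewrite !lee_fin => N0 Nb.
by rewrite -(sqr_sqrtr b0) lerXn2r// nnegrE sqrtr_ge0.
Qed.

Lemma hardy_sqn_ge0 f : 0 <= hardy_sqn f.
Proof. exact: sqr_ge0. Qed.

(** By monotonicity a radius at which the mean is almost the supremum can be increased at will; this
    is how the supremum is used as a limit. *)
Lemma hardy_sqn_approx f (eps : R) : hardy f -> 0 < eps ->
  exists2 r0, unit_radius r0 & forall r, r0 <= r < 1 ->
    ((hardy_sqn f - eps)%:E <= circle_mean2 f r)%E.
Proof.
move=> hf eps0.
have [[r0 r01 hr0]|h] := pselect (exists2 r0, unit_radius r0 &
    ((hardy_sqn f - eps)%:E <= circle_mean2 f r0)%E).
  exists r0 => // r /andP[r0r r1]; apply: (le_trans hr0).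
  by apply: circle_mean2_le => //; [exact: hf.1 | case/andP: r01 => ->].
have : hardy_sqn f <= hardy_sqn f - eps.
  apply: hardy_sqn_le => // r r1; rewrite leNgt; apply/negP => /ltW hr.
  by apply: h; exists r.
lra.
Qed.

Lemma sum_hardy_sqn_approx p (F : 'I_p -> polydisc R n -> R[i]) (eps : R) :
  (forall k, hardy (F k)) -> 0 < eps ->
  exists2 r, unit_radius r &
    ((\sum_k hardy_sqn (F k) - eps)%:E <= \sum_k circle_mean2 (F k) r)%E.
Proof.
move=> hF eps0.
(* The induction needs the bound for all radii beyond [r0], so that the maximum of two thresholds
   serves both parts of the sum. *)
suff [r0 r01 hr0] : exists2 r0, unit_radius r0 & forall r, r0 <= r < 1 ->
    ((\sum_k hardy_sqn (F k) - eps)%:E <= \sum_k circle_mean2 (F k) r)%E.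
  by exists r0 => //; apply: hr0; rewrite lexx; case/andP: r01.
elim: p F hF eps eps0 => [|p IH] F hF eps eps0.
  exists 0 => [|r _]; first by rewrite /unit_radius lexx ltr01.
  by rewrite !big_ord0 lee_fin sub0r oppr_le0 ltW.
have e2 : 0 < eps / 2 by rewrite divr_gt0.
have [r1 r11 h1] := IH (fun k => F (lift ord0 k)) (fun k => hF _) _ e2.
have [r2 r21 h2] := hardy_sqn_approx (hF ord0) e2.
exists (Num.max r1 r2) => [|r].
  by case/andP: r11 => a b; case/andP: r21 => c d; rewrite /unit_radius le_max a gt_max b d.
rewrite ge_max => /andP[/andP[rr1 rr2] rlt].
rewrite !big_ord_recl.
have -> : hardy_sqn (F ord0) + \sum_(i < p) hardy_sqn (F (lift ord0 i)) - eps
  = (hardy_sqn (F ord0) - eps / 2) + (\sum_(i < p) hardy_sqn (F (lift ord0 i)) - eps / 2).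
  by lra.
by rewrite EFinD leeD// ?h1 ?h2// ?rr1 ?rr2.
Qed.

Lemma sum_circle_mean2 p (F : 'I_p -> polydisc R n -> R[i]) r :
  (forall k, hardy (F k)) -> unit_radius r ->
  (\sum_k circle_mean2 (F k) r = \int[unit_cube_prob n]_t
     (\sum_k normc (extend0 (F k) (torus_point r t)) ^+ 2)%:E)%E.
Proof.
move=> hF r1; rewrite /circle_mean2 -ge0_integral_sum//.
- by apply: eq_integral => t _; rewrite sumEFin.
- by move=> k; apply/measurable_EFinP; apply: measurable_circle => //; exact: (hF k).1.
- by move=> k t _; rewrite lee_fin sqr_ge0.
Qed.

(** The sum of the norms of [F] is almost attained at a common radius, where the pointwise identity
    turns it into a sum of means of [G]. All parallelogram-type identities for the norm come from
    here. *)
Lemma le_sum_hardy_sqn p q (F : 'I_p -> polydisc R n -> R[i])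
    (G : 'I_q -> polydisc R n -> R[i]) :
  (forall k, hardy (F k)) -> (forall k, hardy (G k)) ->
  (forall w, \sum_k normc (F k w) ^+ 2 = \sum_k normc (G k w) ^+ 2) ->
  \sum_k hardy_sqn (F k) <= \sum_k hardy_sqn (G k).
Proof.
move=> hF hG FG; apply/ler_addgt0Pr => eps eps0; rewrite -lerBlDr -lee_fin.
have [r r1] := sum_hardy_sqn_approx hF eps0; move=> /le_trans; apply.
rewrite (sum_circle_mean2 hF r1).
have -> : (\int[unit_cube_prob n]_t (\sum_k normc (extend0 (F k) (torus_point r t)) ^+ 2)%:E
  = \int[unit_cube_prob n]_t (\sum_k normc (extend0 (G k) (torus_point r t)) ^+ 2)%:E)%E.
  apply: eq_integral => t _; congr EFin; rewrite /extend0.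
  case: insubP => [w _ _|_]; first exact: FG.
  by rewrite !big1// => k _; rewrite -[oapp _ _ _]/(0 : R[i]) normc0 expr0n.
rewrite -(sum_circle_mean2 hG r1) -sumEFin; apply: lee_sum => k _.
exact: circle_mean2_le_sqn.
Qed.

Lemma eq_sum_hardy_sqn p q (F : 'I_p -> polydisc R n -> R[i])
    (G : 'I_q -> polydisc R n -> R[i]) :
  (forall k, hardy (F k)) -> (forall k, hardy (G k)) ->
  (forall w, \sum_k normc (F k w) ^+ 2 = \sum_k normc (G k w) ^+ 2) ->
  \sum_k hardy_sqn (F k) = \sum_k hardy_sqn (G k).
Proof.
by move=> hF hG FG; apply/eqP; rewrite eq_le !le_sum_hardy_sqn// => w; rewrite FG.
Qed.

Lemma circle_mean2_Mz j f r : unit_radius r -> hardy f ->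
  circle_mean2 (Mz j f) r = ((r ^+ 2)%:E * circle_mean2 f r)%E.
Proof.
move=> r1 hf; rewrite /circle_mean2 -ge0_integralZl//.
- apply: eq_integral => t _; rewrite -EFinM; congr EFin.
  rewrite /extend0; case: insubP => [w _ wE|_]; last first.
    by rewrite -![oapp _ _ _]/(0 : R[i]) normc0 expr0n mulr0.
  rewrite -[oapp (Mz j f) _ _]/(Mz j f w) -[oapp f _ _]/(f w) /Mz normcM exprMn wE mxE normcM normc_expi normcR mulr1.
  by rewrite ger0_norm//; case/andP: r1.
- by apply/measurable_EFinP; apply: measurable_circle => //; exact: hf.1.
- by move=> t _; rewrite lee_fin sqr_ge0.
- by rewrite lee_fin sqr_ge0.
Qed.

Lemma hardy_sqn_Mz j f : hardy f -> hardy (Mz j f) ->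
  hardy_sqn (Mz j f) = hardy_sqn f.
Proof.
move=> hf hzf; apply/eqP; rewrite eq_le; apply/andP; split.
  apply: hardy_sqn_le => // r r1; rewrite circle_mean2_Mz//.
  apply: le_trans (circle_mean2_le_sqn hf r1).
  have := circle_mean2_fin hf r1; have := circle_mean2_ge0 f r.
  case: (circle_mean2 f r) => //= m; rewrite lee_fin => m0 _.
  by rewrite -EFinM lee_fin ler_piMl// exprn_ile1//; case/andP: r1 => // _ /ltW.
apply: hardy_sqn_le => // r r1; set b := hardy_sqn (Mz j f).
have b0 : 0 <= b by exact: hardy_sqn_ge0.
have [r0 rlt] := andP r1.
have := circle_mean2_fin hf r1; case rE : (circle_mean2 f r) => [c| |]//= _.
rewrite lee_fin leNgt; apply/negP => bc.
have c0 : 0 < c := le_lt_trans b0 bc.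
(* With e = (c - b) / (4 c), s^2 is at least 1 - 2 e, so s^2 c is at least (c + b) / 2, which
   exceeds [b]. Since [s] is at least [r], the mean of [f] at [s] is still at least [c]: a
   contradiction. *)
pose s := Num.max r (1 - (c - b) / (4 * c)).
have e0 : 0 < (c - b) / (4 * c) by rewrite divr_gt0 ?mulr_gt0// subr_gt0.
have e1 : (c - b) / (4 * c) * (4 * c) = c - b by rewrite divfK// mulf_neq0// gt_eqF.
have s1 : unit_radius s by rewrite /unit_radius le_max r0 gt_max rlt gtrBl e0.
have rs : r <= s by rewrite le_max lexx.
have : (circle_mean2 (Mz j f) s <= b%:E)%E by exact: circle_mean2_le_sqn.
rewrite circle_mean2_Mz//.
have : (c%:E <= circle_mean2 f s)%E.
  by rewrite -rE; apply: circle_mean2_le; [exact: hf.1 | rewrite r0 | case/andP: s1].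
have := circle_mean2_fin hf s1; case: (circle_mean2 f s) => //= d _.
rewrite -EFinM !lee_fin => cd sdb.
have s_ge : 1 - (c - b) / (4 * c) <= s by rewrite le_max lexx orbT.
set e := (c - b) / (4 * c) in e0 e1 s_ge.
have s2 : 1 - 2 * e <= s ^+ 2 by nra.
have : s ^+ 2 * c <= b by apply: le_trans sdb; rewrite ler_wpM2l ?sqr_ge0.
have : (1 - 2 * e) * c <= s ^+ 2 * c by rewrite ler_pM2r.
by nra.
Qed.

Lemma exists_common_radius (rho : seq R) : all unit_radius rho ->
  exists2 r, unit_radius r & all (fun x => x <= r) rho.
Proof.
elim: rho => [_|x rho IH /= /andP[/andP[x0 x1] /IH[r /andP[r0 r1] hr]]].
  by exists 0; rewrite // /unit_radius lexx ltr01.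
exists (Num.max x r); first by rewrite /unit_radius le_max x0 gt_max x1 r1.
rewrite le_max lexx /=; apply: sub_all hr => y yr.
by rewrite le_max yr orbT.
Qed.

(** Every [w] lies on the torus whose radii are the moduli of its coordinates. These radii lie below
    a common [r], so monotonicity makes the mean over that torus zero, and [polymean_eq0]
    applies. *)
Lemma circle_mean2_eq0 f : analytic f ->
  (forall r, unit_radius r -> circle_mean2 f r = 0%E) -> f = 0.
Proof.
move=> af f0; apply/funext => w.
pose rho := [seq normc (val w ord0 j) | j <- enum 'I_n].
have srho : size rho = n by rewrite size_map size_enum_ord.
have w1 j : normc (val w ord0 j) < 1 by exact: (forallP (valP w)).
have rho1 : all unit_radius rho.
  by apply/allP => _ /mapP[j _ ->]; rewrite /unit_radius normc_ge0 w1.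
have [r r1 rho_r] := exists_common_radius rho1.
have /choice[t ht] : forall j, exists t : R, 0 <= t <= 1 /\
    val w ord0 j = (normc (val w ord0 j))%:C * expi (2 * pi * t).
  move=> j; have [t /andP[t1 t2] wt] := polar_form (val w ord0 j).
  have [t0|t0] := leP 0 t; first by exists t; rewrite t0 t2.
  (* [polar_form] gives an angle in [-1, 1]; a negative one is moved by a full turn into [0, 1]. *)
  exists (t + 1); split; first by apply/andP; split; lra.
  by rewrite mulrDr mulr1 expiD expi_2pi mulr1.
have mean0 : polymean n rho (seqfun f) = 0%E.
  apply/eqP; rewrite eq_le; apply/andP; split; last first.
    by apply: integral_ge0 => s _; rewrite lee_fin sqr_ge0.
  rewrite -(f0 r r1) circle_mean2_polymean; apply: le_polymean => //.
  - by rewrite size_nseq.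
  - exact: seqfun_continuous.
  - exact: seqfun_separately_poly.
  - rewrite all2E size_nseq srho eqxx /=; apply/(all_nthP (0, 0)) => j.
    rewrite size_zip size_nseq srho minnn => jn.
    rewrite nth_zip ?size_nseq//= nth_nseq jn.
    have := all_nthP 0 rho1 j; rewrite srho => /(_ jn)/andP[-> _].
    by have := all_nthP 0 rho_r j; rewrite srho => /(_ jn).
  - by rewrite all_nseq; case/andP: r1 => _ ->; rewrite orbT.
have t01 j : 0 <= tnth (mktuple t) j <= 1 by rewrite tnth_mktuple; case: (ht j).
have := polymean_eq0 srho rho1 (seqfun_continuous af) mean0 t01.
rewrite /seqfun; set z := \row_j _.
have -> : z = val w.
  apply/rowP => j; rewrite mxE nth_torus_seq// (ht j).2.
  by rewrite (nth_map j) ?size_enum_ord// nth_ord_enum -(tnth_nth 0) tnth_mktuple.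
rewrite (extend0E _ (valP w)) => fw; apply: etrans fw.
by congr f; apply/val_inj.
Qed.

End HardySquaredNorm.

(** * Additivity and definiteness of the polarised inner product *)

Section InnerProduct.
Context {R : realType} {n : nat} (S : submodule R n).
Implicit Types (f g h : polydisc R n -> R[i]).

Local Notation iC := ('i : R[i]).

(** Four times the real part of the inner product. *)
Definition polar_diff h f : R := hardy_sqn (h + f) - hardy_sqn (h - f).

Lemma submoduleD f g : f \in S -> g \in S -> f + g \in S.
Proof. exact: rpredD. Qed.

Lemma submoduleN f : f \in S -> - f \in S.
Proof. by rewrite rpredN. Qed.

Lemma submoduleZ a f : f \in S -> a *: f \in S.
Proof. exact: rpredZ. Qed.

Lemma eq_hardy_sqn3 (f1 f2 f3 g1 g2 g3 : polydisc R n -> R[i]) :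
  f1 \in S -> f2 \in S -> f3 \in S -> g1 \in S -> g2 \in S -> g3 \in S ->
  (forall w, normc (f1 w) ^+ 2 + (normc (f2 w) ^+ 2 + normc (f3 w) ^+ 2) =
             normc (g1 w) ^+ 2 + (normc (g2 w) ^+ 2 + normc (g3 w) ^+ 2)) ->
  hardy_sqn f1 + (hardy_sqn f2 + hardy_sqn f3) =
  hardy_sqn g1 + (hardy_sqn g2 + hardy_sqn g3).
Proof.
move=> f1S f2S f3S g1S g2S g3S fg.
pose F (k : 'I_3) := nth 0 [:: f1; f2; f3] k.
pose G (k : 'I_3) := nth 0 [:: g1; g2; g3] k.
have hF k : hardy (F k).
  apply: (submodule_hardy (s := S)); rewrite /F.
  by case: k => [[|[|[|m]]] km].
have hG k : hardy (G k).
  apply: (submodule_hardy (s := S)); rewrite /G.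
  by case: k => [[|[|[|m]]] km].
have := eq_sum_hardy_sqn hF hG; rewrite !big_ord_recl !big_ord0 !addr0; apply.
by move=> w; rewrite !big_ord_recl !big_ord0 !addr0; exact: fg.
Qed.

(** Additivity of the real part of the scalar product, rearranged so that both sides are sums of
    squares, the form that transfers to norms. *)
Lemma normc_sqr_polarization (x y z : R[i]) :
  normc (x + (y + z)) ^+ 2 + (normc (x - y) ^+ 2 + normc (x - z) ^+ 2) =
  normc (x - (y + z)) ^+ 2 + (normc (x + y) ^+ 2 + normc (x + z) ^+ 2).
Proof. by case: x y z => [x1 x2] [y1 y2] [z1 z2]; rewrite !normc_sqr /=; ring. Qed.

Lemma polar_diffD h f g : h \in S -> f \in S -> g \in S ->
  polar_diff h (f + g) = polar_diff h f + polar_diff h g.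
Proof.
move=> hS fS gS; rewrite /polar_diff.
have := @eq_hardy_sqn3 (h + (f + g)) (h - f) (h - g) (h - (f + g)) (h + f) (h + g).
rewrite !(submoduleD, submoduleN)// => /(_ isT isT isT isT isT isT) E.
have := E (fun w => normc_sqr_polarization (h w) (f w) (g w)).
move: (hardy_sqn (h + (f + g))) (hardy_sqn (h - f)) (hardy_sqn (h - g))
  (hardy_sqn (h - (f + g))) (hardy_sqn (h + f)) (hardy_sqn (h + g)).
by clear=> a b c a' b' c'; lra.
Qed.

Lemma sum_powers_i (phi : R[i] -> R[i]) :
  \sum_(k < 4) iC ^+ k * phi (iC ^+ k) =
  phi 1 - phi (-1) + iC * (phi iC - phi (- iC)).
Proof.
have i2 : iC ^+ 2 = -1 by exact: sqrCi.
have i3 : iC ^+ 3 = - iC by rewrite exprS i2 mulrN1.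
rewrite -(big_mkord xpredT (fun k => iC ^+ k * phi (iC ^+ k))).
rewrite !big_nat_recr// big_geq//= add0r expr0 expr1 i2 i3; ring.
Qed.

Lemma hardy_innerE h f :
  hardy_inner h f = 4^-1 * ((polar_diff h f)%:C + iC * (polar_diff h (iC *: f))%:C).
Proof.
rewrite /hardy_inner (sum_powers_i (fun c => ((fine (hardy_norm (h + c *: f))) ^+ 2)%:C)).
by rewrite scaleN1r scale1r scaleNr -!rmorphB.
Qed.

Lemma hardy_innerD h f g : h \in S -> f \in S -> g \in S ->
  hardy_inner h (f + g) = hardy_inner h f + hardy_inner h g.
Proof.
move=> hS fS gS; rewrite !hardy_innerE scalerDr !polar_diffD ?submoduleZ//.
by rewrite !rmorphD /= -mulrDr; congr (_ * _); rewrite mulrDr addrACA.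
Qed.

Lemma hardy_sqn_eq0 f : hardy f -> hardy_sqn f = 0 -> f = 0.
Proof.
move=> hf f0; apply: circle_mean2_eq0; first exact: hf.1.
move=> r r1; apply/eqP; rewrite eq_le circle_mean2_ge0 andbT.
by have := circle_mean2_le_sqn hf r1; rewrite f0.
Qed.

Lemma hardy_sqn0 : hardy_sqn (0 : polydisc R n -> R[i]) = 0.
Proof.
have h0 : hardy (0 : polydisc R n -> R[i]).
  by apply: (submodule_hardy (s := S)); exact: rpred0.
apply/eqP; rewrite eq_le hardy_sqn_ge0 andbT; apply: hardy_sqn_le => // r _.
rewrite /circle_mean2 (eq_integral (cst 0%E)) ?integral0// => t _.
rewrite /extend0; case: insubP => [w _ _|_]; rewrite -[oapp _ _ _]/(0 : R[i]) normc0 expr0n//.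
Qed.

Lemma complex_ReIm_eq0 (a b : R) : a%:C + iC * b%:C = 0 -> a = 0.
Proof.
move=> /eqP; rewrite eq_complex /= => /andP[/eqP + _].
by rewrite ?mul0r ?mulr0 ?subr0 ?addr0 ?oppr0 ?mul1r ?addr0.
Qed.

(** The real part of the inner product is a quarter of the squared norm of f + f minus that of 0, so
    its vanishing gives f + f = 0. *)
Lemma hardy_inner_definite f : f \in S -> hardy_inner f f = 0 -> f = 0.
Proof.
move=> fS; rewrite hardy_innerE => /eqP; rewrite mulf_eq0 invr_eq0 pnatr_eq0 /=.
move=> /eqP/complex_ReIm_eq0; rewrite /polar_diff subrr hardy_sqn0 subr0.
have ffS : f + f \in S by exact: submoduleD.
move=> /(hardy_sqn_eq0 (submodule_hardy ffS)) ff0; apply/funext => w.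
have /eqP : f w + f w = 0 by exact: (congr1 (@^~ w) ff0).
by rewrite -mulr2n mulrn_eq0 /= => /eqP.
Qed.

Lemma Mz_comb j c f g : Mz j f + c *: Mz j g = Mz j (f + c *: g).
Proof.
apply/funext => w; rewrite /Mz /=.
rewrite -[LHS]/(val w ord0 j * f w + c * (val w ord0 j * g w)).
rewrite -[RHS]/(val w ord0 j * (f w + c * g w)); ring.
Qed.

Lemma hardy_inner_Mz j f g : f \in S -> g \in S ->
  hardy_inner (Mz j f) (Mz j g) = hardy_inner f g.
Proof.
move=> fS gS; rewrite /hardy_inner; congr (_ * _); apply: eq_bigr => k _.
have fgS : f + 'i ^+ k *: g \in S by rewrite submoduleD ?submoduleZ.
rewrite Mz_comb -/(hardy_sqn _) hardy_sqn_Mz//.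
  exact: (submodule_hardy fgS).
exact: (submodule_hardy (submodule_Mz j fgS)).
Qed.

End InnerProduct.

(** * Defect operators *)

Section DefectOperators.
Context {R : realType} {n : nat} (S : submodule R n).
Local Notation E := (submodule_sort S).
Implicit Types (f g h u : E) (i j : 'I_n).

Definition orthogonal_to_range j u :=
  forall h, hardy_inner (Mz j (val h)) (val u) = 0.

Definition defect j f : E := f - Rz S j (adjoint (Rz S j) f).

(** Either the default value 0 is returned, or an [h] orthogonal to all of the submodule, in
    particular to itself. *)
Lemma adjoint_orthogonal j u : orthogonal_to_range j u ->
  adjoint (Rz S j) u = 0.
Proof.
move=> ju; rewrite /adjoint; case: xgetP => [h _ hP|//].
apply: val_inj; apply: hardy_inner_definite (valP h) _.
by rewrite -(hP h); exact: ju.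
Qed.

Lemma Rz0 j : Rz S j 0 = 0.
Proof. by apply: val_inj; apply/funext => w; exact: mulr0. Qed.

Lemma defect_orthogonal_id j u : orthogonal_to_range j u -> defect j u = u.
Proof. by move=> /adjoint_orthogonal ju; rewrite /defect ju Rz0 subr0. Qed.

(* By the Riesz representation theorem the second alternative is vacuous;
   allowing for it replaces the proof that adjoints exist. *)
Lemma defect_cases j f : orthogonal_to_range j (defect j f) \/ defect j f = f.
Proof.
rewrite /defect /adjoint; case: xgetP => [h _ hP|_]; last by right; rewrite Rz0 subr0.
left => g; set u := f - _.
(* Both inner products of z_j g with f and with z_j h equal that of g with h, by the defining
   property of the adjoint and by isometry; additivity leaves 0 for [u]. *)
have := hP g; have -> : val f = val u + Mz j (val h).
  by rewrite -[Mz j (val h)]/(val (Rz S j h)) -raddfD /= subrK.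
have zS (k : E) : Mz j (val k) \in S by exact: submodule_Mz (submodule_valP k).
rewrite (hardy_innerD (zS g) (submodule_valP u) (zS h)).
rewrite (hardy_inner_Mz j (submodule_valP g) (submodule_valP h)).
by move=> /eqP; rewrite -subr_eq0 addrK => /eqP.
Qed.

Lemma circle_mean2_Rz j g r : unit_radius r ->
  circle_mean2 (val (Rz S j g)) r = ((r ^+ 2)%:E * circle_mean2 (val g) r)%E.
Proof. by move=> r1; apply: circle_mean2_Mz => //; exact: submodule_hardy (valP g). Qed.

Lemma hardy_sqn_Rz j g : hardy_sqn (val (Rz S j g)) = hardy_sqn (val g).
Proof.
apply: hardy_sqn_Mz; first exact: submodule_hardy (valP g).
exact: submodule_hardy (valP (Rz S j g)).
Qed.

(* Dividing k times by coordinates keeps the norm but forces the mean over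
   the torus of radius r below r^(2k) times the squared norm. *)
Lemma infinitely_divisible_eq0 (P : E -> Prop) :
  (forall u, P u -> exists i g, u = Rz S i g /\ P g) -> forall u, P u -> u = 0.
Proof.
move=> divP.
have bound k u r : P u -> unit_radius r ->
    (circle_mean2 (val u) r <= ((r ^+ 2) ^+ k * hardy_sqn (val u))%:E)%E.
  move=> Pu r1; elim: k u Pu => [|k IH] u Pu.
    rewrite expr0 mul1r; apply: circle_mean2_le_sqn => //.
    exact: submodule_hardy (valP u).
  have [i [g [-> Pg]]] := divP _ Pu.
  rewrite circle_mean2_Rz// hardy_sqn_Rz [(r ^+ 2) ^+ k.+1]exprS -mulrA [(r ^+ 2 * _)%:E]EFinM.
  by apply: lee_pmul (IH _ Pg); rewrite ?lee_fin ?sqr_ge0 ?circle_mean2_ge0.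
move=> u Pu; have hu := submodule_hardy (valP u).
apply: val_inj; apply: circle_mean2_eq0; first exact: hu.1.
move=> r r1; apply/eqP; rewrite eq_le circle_mean2_ge0 andbT.
have q1 : `|r ^+ 2| < 1.
  by case/andP: r1 => r0 r1; rewrite ger0_norm ?sqr_ge0// expr_lt1.
have cvg0 : (fun k => (r ^+ 2) ^+ k * hardy_sqn (val u)) @ \oo --> (0 : R).
  by rewrite -[X in _ --> X](mul0r (hardy_sqn (val u))); apply: cvgMl; exact: cvg_expr.
have := circle_mean2_fin hu r1.
have {}bound k := bound k u r Pu r1.
case: (circle_mean2 (val u) r) bound => [c| |]//= bound _.
rewrite lee_fin -(cvg_lim _ cvg0)//; apply: limr_ge.
  by apply/cvg_ex; exists 0.
by apply: nearW => k; rewrite -lee_fin.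
Qed.

(** If P_j f = f, the hypothesis reads P_i f = 0 and f is divisible by z_i. Otherwise P_j f is
    orthogonal to the range of z_j, infinite division by z_i makes it 0, and f is divisible by
    z_j. *)
Lemma defect_product_eq0 i j : i != j ->
  (forall f, defect i (defect j f) = 0) ->
  forall f, exists k g, f = Rz S k g.
Proof.
move=> ij ij0 f.
have in_range u : defect i u = 0 -> u = Rz S i (adjoint (Rz S i) u).
  by move=> /eqP; rewrite subr_eq0 => /eqP.
have [uj|fj] := defect_cases j f; last first.
  by exists i, (adjoint (Rz S i) f); apply: in_range; rewrite -{1}fj.
have u0 : defect j f = 0.
  apply: (@infinitely_divisible_eq0 (orthogonal_to_range j)) uj => u ju.
  have uE := in_range u; rewrite -{1}(defect_orthogonal_id ju) in uE.
  have {}uE := uE (ij0 u); exists i, (adjoint (Rz S i) u); split => // h.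
  set g := adjoint _ _ in uE *.
  (* Orthogonality passes to the quotient [g]: multiplying both sides by z_i changes nothing, turns
     [g] into [u], and z_i z_j h is again z_j times an element of the submodule. *)
  rewrite -(hardy_inner_Mz i (submodule_Mz j (submodule_valP h)) (submodule_valP g)).
  rewrite -[Mz i (val g)]/(val (Rz S i g)) -uE.
  have -> : Mz i (Mz j (val h)) = Mz j (val (Rz S i h)).
    by apply/funext => w; exact: mulrCA.
  exact: ju.
by exists j, (adjoint (Rz S j) f); apply/eqP; rewrite -subr_eq0; apply/eqP.
Qed.

End DefectOperators.

Theorem proposition2p2 (R : realType) (n : nat) (hn : (2 <= n)%N)
    (S : submodule R n) :
  (forall i j : 'I_n, i != j ->
     (idfun \- (Rz S i \o adjoint (Rz S i)))
       \o (idfun \- (Rz S j \o adjoint (Rz S j)))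
     = (fun _ : submodule_sort S => 0))
  <-> [set f : polydisc R n -> R[i] | f \in S] = [set 0].
Proof.
split=> [H|S0 i j _].
  pose i : 'I_n := Ordinal (ltnW hn : (0 < n)%N); pose j : 'I_n := Ordinal hn.
  have ij : i != j by [].
  have all0 (f : submodule_sort S) : f = 0.
    (* Every element is divisible by some coordinate, with a quotient of which the same holds; the
       coordinate may vary from one division to the next. *)
    apply: (@infinitely_divisible_eq0 _ _ S (fun _ => True)) => // u _.
    have [|k [g ->]] := @defect_product_eq0 _ _ S _ _ ij _ u; last by exists k, g.
    by move=> h; exact: (congr1 (@^~ h) (H _ _ ij)).
  apply/seteqP; split => [f /= fS|f /= ->]; last exact: rpred0.
  exact: (congr1 val (all0 (SubmoduleElt fS))).
apply/funext => f; apply: val_inj.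
(* For the converse the submodule has a single element, so both sides agree whatever value the
   adjoint takes. *)
have val0 (g : submodule_sort S) : val g = 0.
  have : [set f : polydisc R n -> R[i] | f \in S] (val g) by exact: valP.
  by rewrite S0.
by rewrite !val0.
Qed.
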